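(* Let $n\ge3$. Let $X_{n+2}$ be the affine cone over the Grassmannian $\mathrm{Gr}_{2,n+2}$ in its Plücker embedding with Plücker coordinates $\Delta_{ab}$ ($1\le a<b\le n+2$), let $X\subset X_{n+2}$ be the divisor given by $\Delta_{n+1,n+2}=0$, so that $\mathbb{C}[X]=\mathbb{C}[X_{n+2}]/\langle\Delta_{n+1,n+2}\rangle$, and let $\mathbb{Z}[X]$ be the $\mathbb{Z}$-form of $\mathbb{C}[X]$ generated by all Plücker coordinates. Let $\mathcal{A}_\circ$ be the special cluster algebra of type $D_n$ defined in the context, whose cluster variables are labeled by the $\Theta$-orbits of diagonals of a regular $2n$-gon with vertices labeled $1,\dots,n,\overline1,\dots,\overline n$ in counterclockwise order, each diameter occurring in two colors $[a,\overline a]$ and $\widetilde{[a,\overline a]}$, and whose coefficient generators are labeled by the $\Theta$-orbits of sides. The correspondence sending each cluster variable and each coefficient for $\mathcal{A}_\circ$ to the element with the same label in the list $$[a,\overline a]\mapsto\Delta_{a\overline a}=\Delta_{a,n+1}\quad(1\le a\le n),\qquad \widetilde{[a,\overline a]}\mapsto\tilde\Delta_{a\overline a}=\Delta_{a,n+2}\quad(1\le a\le n),$$ $$\{[a,b],[\overline a,\overline b]\}\mapsto\Delta_{ab}\quad(1\le a<b\le n),$$ $$\{[a,\overline b],[\overline a,b]\}\mapsto\Delta_{a\overline b}=\Delta_{a,n+1}\Delta_{b,n+2}-\Delta_{ab}\quad(1\le a<b\le n)$$ extends uniquely to an algebra isomorphism between $\mathcal{A}_\circ$ and $\mathbb{Z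}[X]$.
   Context: Cluster algebras. A semifield $(\mathbb{P},\oplus,\cdot)$ is an abelian multiplicative group with a commutative, associative operation $\oplus$ over which multiplication distributes. $\mathrm{Trop}(p_j:j\in J)$ ($J$ finite) is the semifield whose multiplicative group is free abelian on the $p_j$, with $\prod_jp_j^{a_j}\oplus\prod_jp_j^{b_j}=\prod_jp_j^{\min(a_j,b_j)}$. The ambient field $\mathcal{F}$ is isomorphic to the field of rational functions in $n$ variables with coefficients in $\mathbb{Z}\mathbb{P}$. A seed is $(\mathbf{x},\mathbf{p},B)$ with $\mathbf{x}\subset\mathcal{F}$ an $n$-element transcendence basis over the fraction field of $\mathbb{Z}\mathbb{P}$; $\mathbf{p}=(p_x^\pm)_{x\in\mathbf{x}}$ in $\mathbb{P}$ with $p_x^+\oplus p_x^-=1$; $B=(b_{xy})_{x,y\in\mathbf{x}}$ an integer matrix with, for all $x,y$, either $b_{xy}=b_{yx}=0$ or $b_{xy}b_{yx}<0$. Mutation at $z\in\mathbf{x}$: replace $z$ by $\overline z$ given by the exchange relation $z\overline z=p_z^+\prod_{b_{xz}>0}x^{b_{xz}}+p_z^-\prod_{b_{xz}<0}x^{-b_{xz}}$; new coefficients are normalized and satisfy $\overline p_x^+/\overline p_x^-=p_z^-/p_z^+$ if $x=\overline z$, $=(p_z^+)^{b_{zx}}p_x^+/p_x^-$ if $b_{zx}\ge0$, $=(p_z^-)^{b_{zx}}p_x^+/p_x^-$ if $b_{zx}\le0$; $B$ is replaced by $b'_{xy}=-b_{xy}$ if $x=z$ or $y=z$, $b'_{xy}=b_{xy}+\frac{|b_{xz}|b_{zy}+b_{xz}|b_{zy}|}{2}$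 otherwise, with the index $z$ relabeled $\overline z$. The cluster algebra generated from an initial seed is the subring of $\mathcal{F}$ generated by all cluster variables (elements of the sets $\mathbf{x}$) and all coefficients $p_x^\pm$ of all seeds obtained by iterated mutations. It is of type $D_n$ if some seed matrix $B$ has Cartan counterpart ($a_{xx}=2$, $a_{xy}=-|b_{xy}|$ for $x\neq y$) the Cartan matrix of type $D_n$ (with $D_3=A_3$). The algebra $\mathcal{A}_\circ$ of type $D_n$. Let $\Theta$ be the $180^\circ$ rotation of the regular $2n$-gon $\mathbf{P}_{2n}$, and $\overline a=\Theta(a)$ the vertex antipodal to $a$ (so $\overline{\overline a}=a$). Consider the $\Theta$-orbits of diagonals, where each diameter comes in two colors, denoted $[a,\overline a]$ and $\widetilde{[a,\overline a]}$. Two orbits are non-crossing if the diagonals they involve do not cross (two diagonals cross if they are distinct and have a common interior point), with the conventions that diameters of the same color do not cross each other, and that two diameters of different colors cross exactly when their locations are different. Let $\mathbb{P}=\mathrm{Trop}(p_\delta)$, where $\delta$ runs over the $n$ centrally symmetric pairs of sides of $\mathbf{P}_{2n}$; for $\delta=\{[a,b],[\overline a,\overline b]\}$ write $p_\delta=p_{ab}=p_{\overline a\,\overline b}$. $\mathcal{A}_\circ$ is the cluster algebra of type $D_n$ over $\mathbb{P}$ whose cluster variables are $x_{ab}=x_{ba}=x_{\overline a\,\overline b}$ for all diagonals $[a,b]$ and $\tilde x_{a\overline a}$ for the diameters $\widetilde{[a,\overline a]}$, whose clusters correspond to the maximal sets of pairwise non-crossing orbits, and whose exchange relations are the following (with the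 convention $x_{ab}=1$ if $[a,b]$ is a side): (1) $x_{ac}x_{bd}=p^+x_{ab}x_{cd}+p^-x_{ad}x_{bc}$ whenever $a,b,c,d,\overline a$ are in counterclockwise order; (2) $x_{ac}x_{a\overline b}=p^+x_{ab}x_{a\overline c}+p^-x_{a\overline a}\tilde x_{a\overline a}x_{bc}$ whenever $a,b,c,\overline a$ are in counterclockwise order; (3) $x_{a\overline a}\tilde x_{b\overline b}=p^+x_{ab}+p^-x_{a\overline b}$ whenever $a,b,\overline a$ are in counterclockwise order; (4) $x_{a\overline a}x_{b\overline c}=p^+x_{ab}x_{c\overline c}+p^-x_{a\overline c}x_{b\overline b}$ and (5) $\tilde x_{a\overline a}x_{b\overline c}=p^+x_{ab}\tilde x_{c\overline c}+p^-x_{a\overline c}\tilde x_{b\overline b}$ whenever $a,b,c,\overline a$ are in counterclockwise order. Here, in each relation, the coefficient of a monomial is obtained from that monomial by replacing each factor $x_{ab}$ by $p_{ab}$ if $[a,b]$ is a side, and all other factors by $1$. Such a cluster algebra exists, and the matrix and coefficients of a seed are read off from the exchange relations, up to the simultaneous change $B\to-B$, $p^+\leftrightarrow p^-$, which does not affect the algebra. The affine cone over $\mathrm{Gr}_{2,m}$ is the variety of decomposable bivectors in $\bigwedge^2\mathbb{C}^m$. In $\mathbb{Z}[X]$ one has $\Delta_{a,n+1}\Delta_{b,n+2}=\Delta_{a,n+2}\Delta_{b,n+1}$. *)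

(* Defs.v *)
From HB Require Import structures.
From mathcomp Require Import all_boot all_order perm all_algebra.
From mathcomp Require Import generic_quotient ring_quotient mpoly.
From mathcomp Require Import boolp.

Set Implicit Arguments.
Unset Strict Implicit.
Unset Printing Implicit Defensive.

Import Order.TTheory GRing.Theory Num.Theory.
Local Open Scope ring_scope.

Section GeneratedSubring.
Variables (A : comNzRingType) (S : A -> Prop).

Inductive in_subring : A -> Prop :=
| in_subring_gen y : S y -> in_subring y
| in_subring_one : in_subring 1
| in_subring_sub y z : in_subring y -> in_subring z -> in_subring (y - z)
| in_subring_mul y z : in_subring y -> in_subring z -> in_subring (y * z).

Definition subring_pred : {pred A} := fun y => `[< in_subring y >].

Fact subring_pred_closed : subring_closed subring_pred.
Proof.
split=> [|y z /asboolP hy /asboolP hz|y z /asboolP hy /asboolP hz].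
- exact/asboolP/in_subring_one.
- exact/asboolP/in_subring_sub.
- exact/asboolP/in_subring_mul.
Qed.

HB.instance Definition _ :=
  GRing.isSubringClosed.Build A subring_pred subring_pred_closed.

Record subring : Type := Subring {
  subring_val : A;
  _ : subring_val \in subring_pred }.

HB.instance Definition _ := [isSub for subring_val].
HB.instance Definition _ := [Choice of subring by <:].
HB.instance Definition _ := [SubChoice_isSubComNzRing of subring by <:].

End GeneratedSubring.

Section Fields.
Variable F : fieldType.

Inductive in_subfield (S : F -> Prop) : F -> Prop :=
| in_subfield_gen y : S y -> in_subfield S y
| in_subfield_one : in_subfield S 1
| in_subfield_sub y z :
    in_subfield S y -> in_subfield S z -> in_subfield S (y - z)
| in_subfield_mul y z :
    in_subfield S y -> in_subfield S z -> in_subfield S (y * z)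
| in_subfield_inv y : in_subfield S y -> in_subfield S y^-1.

Definition alg_independent (E : F -> Prop) n (x : 'I_n -> F) : Prop :=
  forall Q : {mpoly F[n]}, (forall m, E Q@_m) -> Q.@[x] = 0 -> Q = 0.

Definition algebraic_over (E : F -> Prop) (y : F) : Prop :=
  exists q : {poly F}, [/\ q != 0, forall i, E q`_i & root q y].

End Fields.

(* A Laurent monomial in the generators p_j is given by its exponent vector:
   the multiplication of Trop(p_j) is the addition of [trop J], its unit is 0,
   and the power p ^ b is [p *~ b]. *)
Definition trop (J : finType) := {ffun J -> int}.

Definition trop_oplus (J : finType) (c d : trop J) : trop J :=
  [ffun j => Num.min (c j) (d j)].

Definition trop_gen (J : finType) (j : J) : trop J := [ffun i => (i == j)%:R].

Definition trop_val (J : finType) (F : fieldType) (p : J -> F) (c : trop J) : F :=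
  \prod_j p j ^ c j.

Section Cluster.
Variables (n : nat) (J : finType) (F : fieldType).
Variable p : J -> F.

(* The fraction field of ZP, inside F. *)
Definition coef_field : F -> Prop := in_subfield (fun y => exists j, y = p j).

Definition coef_field_adj (x : 'I_n -> F) : F -> Prop :=
  in_subfield (fun y => (exists j, y = p j) \/ (exists i, y = x i)).

(* F is the field of rational functions in n variables with coefficients in ZP,
   the p_j being the generators of P = Trop(p_j): the first clause says that ZP
   embeds in F, the second one that F = Frac(ZP)(u_1, ..., u_n). *)
Definition ambient : Prop :=
  (forall Q : {mpoly int[#|J|]},
     (map_mpoly intr Q).@[fun i => p (enum_val i)] = 0 -> Q = 0) /\
  exists u : 'I_n -> F,
    alg_independent coef_field u /\ (forall y, coef_field_adj u y).

Definition transcendence_basis (x : 'I_n -> F) : Prop :=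
  alg_independent coef_field x /\
  (forall y, algebraic_over (coef_field_adj x) y).

(* The n-element cluster and the data indexed by it are listed by 'I_n. *)
Record seed : Type := Seed {
  cvar : 'I_n -> F;
  pplus : 'I_n -> trop J;
  pminus : 'I_n -> trop J;
  bmat : 'M[int]_n;
  seed_basis : transcendence_basis cvar;
  seed_normalized : forall i, trop_oplus (pplus i) (pminus i) = 0;
  seed_sign : forall i j,
    (bmat i j = 0 /\ bmat j i = 0) \/ bmat i j * bmat j i < 0 }.

Definition mon_plus (s : seed) (k : 'I_n) : F :=
  \prod_(i | 0 < bmat s i k) cvar s i ^ bmat s i k.

Definition mon_minus (s : seed) (k : 'I_n) : F :=
  \prod_(i | bmat s i k < 0) cvar s i ^ (- bmat s i k).

Record mutation (k : 'I_n) (s t : seed) : Prop := {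
  mut_keep : forall i, i != k -> cvar t i = cvar s i;
  mut_exchange :
    cvar s k * cvar t k = trop_val p (pplus s k) * mon_plus s k
                        + trop_val p (pminus s k) * mon_minus s k;
  mut_coef_k : pplus t k - pminus t k = pminus s k - pplus s k;
  mut_coef_ge0 : forall i, i != k -> 0 <= bmat s k i ->
    pplus t i - pminus t i
      = pplus s k *~ bmat s k i + (pplus s i - pminus s i);
  mut_coef_le0 : forall i, i != k -> bmat s k i <= 0 ->
    pplus t i - pminus t i
      = pminus s k *~ bmat s k i + (pplus s i - pminus s i);
  mut_bmat : forall i j, bmat t i j =
    if (i == k) || (j == k) then - bmat s i j
    else bmat s i j + ((`|bmat s i k| * bmat s k j
                        + bmat s i k * `|bmat s k j|) %/ 2)%Z }.

Inductive mutation_equivalent (s0 : seed) : seed -> Prop :=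
| mutation_equivalent_refl : mutation_equivalent s0 s0
| mutation_equivalent_step k s t :
    mutation_equivalent s0 s -> mutation k s t -> mutation_equivalent s0 t.

Definition cluster_generator (s0 : seed) (y : F) : Prop :=
  exists s i, mutation_equivalent s0 s /\
    [\/ y = cvar s i, y = trop_val p (pplus s i)
      | y = trop_val p (pminus s i)].

Definition cluster_algebra (s0 : seed) := subring (cluster_generator s0).

Definition cartan_counterpart (B : 'M[int]_n) : 'M[int]_n :=
  \matrix_(i, j) (if i == j then 2 else - `|B i j|).

(* Dynkin diagram D_n, n >= 3, on the nodes 0, ..., n-1: the path
   0 - 1 - ... - (n-2), together with the edge (n-3) - (n-1). *)
Definition D_edge (i j : nat) : bool :=
  (i.+1 == j) && (j < n.-1)%N || (i == n - 3)%N && (j == n.-1).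

Definition cartan_D : 'M[int]_n :=
  \matrix_(i, j) (if i == j then 2 else - (D_edge i j || D_edge j i)%:R).

Definition type_D (s0 : seed) : Prop :=
  exists s (w : 'S_n), mutation_equivalent s0 s /\
    forall i j, cartan_counterpart (bmat s) (w i) (w j) = cartan_D i j.

End Cluster.

Section Polygon.
Variable n : nat.

(* Vertices in counterclockwise order; [lshift n a] and [rshift n a] are the
   vertices labeled a and \overline a. *)
Definition vertex : finType := 'I_(n + n).

Definition antipode (a : vertex) : vertex :=
  match split a with inl i => rshift n i | inr i => lshift n i end.

Definition ccw_dist (a b : vertex) : nat := (b + (n + n) - a) %% (n + n).

Definition ccw (s : seq vertex) : bool :=
  if s is a :: _ then sorted ltn [seq ccw_dist a b | b <- s] else true.

Definition side (a b : vertex) : bool :=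
  (ccw_dist a b == 1%N) || (ccw_dist b a == 1%N).

Definition diagonal (a b : vertex) : bool := (a != b) && ~~ side a b.

Definition orbit (a b : vertex) : {set {set vertex}} :=
  [set [set a; b]; [set antipode a; antipode b]].

(* An orbit of chords together with a color; the color [true] (tilde) is only
   meaningful for diameters. *)
Definition symbol : finType := ({set {set vertex}} * bool)%type.

Definition plain (a b : vertex) : symbol := (orbit a b, false).
Definition tilde (a : vertex) : symbol := (orbit a (antipode a), true).

Definition is_label (s : symbol) : bool :=
  [exists a, exists b, diagonal a b && (s == plain a b)]
  || [exists a, s == tilde a].

Definition label : finType := {s : symbol | is_label s}.

Definition is_side_orbit (O : {set {set vertex}}) : bool :=
  [exists a, exists b, side a b && (O == orbit a b)].

Definition side_orbit : finType := {O : {set {set vertex}} | is_side_orbit O}.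

Definition chords_cross (c d : {set vertex}) : bool :=
  [exists a, exists a', exists b, exists b',
    [&& c == [set a; a'], d == [set b; b'] & ccw [:: a; b; a'; b']]].

Definition is_diameter (s : symbol) : bool :=
  [exists a, s.1 == orbit a (antipode a)].

Definition crossing (s t : symbol) : bool :=
  if is_diameter s && is_diameter t then (s.2 != t.2) && (s.1 != t.1)
  else [exists c in s.1, exists d in t.1, chords_cross c d].

Definition noncrossing (L : {set label}) : bool :=
  [forall s in L, forall t in L, ~~ crossing (val s) (val t)].

(* [special_exchange s t M N]: the exchange relation s t = p^+ M + p^- N, the
   monomials being listed with their factors equal to sides. *)
Inductive special_exchange :
    symbol -> symbol -> seq symbol -> seq symbol -> Prop :=
| special_exchange1 a b c d : ccw [:: a; b; c; d; antipode a] ->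
    special_exchange (plain a c) (plain b d)
      [:: plain a b; plain c d] [:: plain a d; plain b c]
| special_exchange2 a b c : ccw [:: a; b; c; antipode a] ->
    special_exchange (plain a c) (plain a (antipode b))
      [:: plain a b; plain a (antipode c)]
      [:: plain a (antipode a); tilde a; plain b c]
| special_exchange3 a b : ccw [:: a; b; antipode a] ->
    special_exchange (plain a (antipode a)) (tilde b)
      [:: plain a b] [:: plain a (antipode b)]
| special_exchange4 a b c : ccw [:: a; b; c; antipode a] ->
    special_exchange (plain a (antipode a)) (plain b (antipode c))
      [:: plain a b; plain c (antipode c)]
      [:: plain a (antipode c); plain b (antipode b)]
| special_exchange5 a b c : ccw [:: a; b; c; antipode a] ->
    special_exchange (tilde a) (plain b (antipode c))
      [:: plain a b; tilde c]
      [:: plain a (antipode c); tilde b].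

Definition side_coef (s : symbol) : trop side_orbit :=
  oapp (@trop_gen side_orbit) 0 (insub s.1).

Definition mon_coef (M : seq symbol) : trop side_orbit :=
  \sum_(s <- M) side_coef s.

Section Special.
Variables (F : fieldType) (p : side_orbit -> F) (x : label -> F).

(* The cluster variable with a given label, and 1 for a side. *)
Definition symbol_var (s : symbol) : F := oapp x 1 (insub s).

Definition mon_var (M : seq symbol) : F := \prod_(s <- M) symbol_var s.

(* The cluster variable (for a diagonal) or the generator of P (for a side). *)
Definition symbol_elt (s : symbol) : F := oapp p (symbol_var s) (insub s.1).

(* Exchange relations are compared up to exchanging the two sides of a mutation,
   and the two terms p^+ M^+ and p^- M^- (that is, up to B -> -B together with
   p^+ <-> p^-); each term is the pair of its coefficient and its monomial. *)
Definition same_exchange (k : 'I_n) (s t : seed n p)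
    (z z' : symbol) (M N : seq symbol) : Prop :=
  perm_eq [:: cvar s k; cvar t k] [:: symbol_var z; symbol_var z'] /\
  perm_eq [:: (pplus s k, mon_plus s k); (pminus s k, mon_minus s k)]
          [:: (mon_coef M, mon_var M); (mon_coef N, mon_var N)].

(* The cluster algebra generated from the seed s0 is the special cluster algebra
   of type D_n, its cluster variables being labeled by x. *)
Record special_D (s0 : seed n p) : Prop := {
  special_type : type_D s0;
  special_label_inj : injective x;
  special_variables : forall y,
    (exists l, y = x l) <->
    (exists s i, mutation_equivalent s0 s /\ y = cvar s i);
  special_clusters : forall L : {set label},
    maxset noncrossing L <->
    (exists2 s, mutation_equivalent s0 s
       & forall l, l \in L <-> exists i, x l = cvar s i);
  special_exchange_only : forall k s t,
    mutation_equivalent s0 s -> mutation k s t ->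
    exists z z' M N,
      special_exchange z z' M N /\ same_exchange k s t z z' M N;
  special_exchange_all : forall z z' M N, special_exchange z z' M N ->
    exists k s t,
      [/\ mutation_equivalent s0 s, mutation k s t
        & same_exchange k s t z z' M N] }.

End Special.

End Polygon.

Section Cone.
Variables (C : fieldType) (m : nat).

Definition plucker_index : finType := {ij : 'I_m * 'I_m | (ij.1 < ij.2)%N}.

(* Bivectors are given by their coordinates in the basis e_i ^ e_j, i < j. *)
Definition bivector := 'I_#|plucker_index| -> C.

Definition decomposable (w : bivector) : Prop :=
  exists u v : 'rV[C]_m, forall k : plucker_index,
    let: (i, j) := val k in
    w (enum_rank k) = u 0 i * v 0 j - u 0 j * v 0 i.

Definition bivector_poly := {mpoly C[#|plucker_index|]}.

Definition cone_ideal : {pred bivector_poly} :=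
  fun f => `[< forall w, decomposable w -> f.@[w] = 0 >].

Fact decomposable0 : decomposable (fun=> 0).
Proof.
exists 0, 0 => k; case: (val k) => i j.
by rewrite !mxE mulr0 subr0.
Qed.

Fact cone_ideal_closed : idealr_closed cone_ideal.
Proof.
split.
- by apply/asboolP => w _; rewrite meval0.
- apply/negP => /asboolP /(_ _ decomposable0) /eqP.
  by rewrite meval1 oner_eq0.
- move=> a f g /asboolP hf /asboolP hg; apply/asboolP => w hw.
  by rewrite mevalD mevalM hf // hg // mulr0 addr0.
Qed.

HB.instance Definition _ :=
  isIdealr.Build bivector_poly cone_ideal cone_ideal_closed.

(* C[X_m]: polynomials on bivectors modulo those vanishing on the cone. *)
Definition cone_ring := {ideal_quot cone_ideal}.
HB.instance Definition _ := GRing.ComNzRing.on cone_ring.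

Definition plucker_poly (i j : 'I_m) : bivector_poly :=
  oapp (fun k : plucker_index => 'X_(enum_rank k)) 0 (insub (i, j)).

(* Only meaningful for i < j. *)
Definition cone_plucker (i j : 'I_m) : cone_ring :=
  (\pi_({ideal_quot cone_ideal}) (plucker_poly i j))%qT.

End Cone.

Section Divisor.
Variables (C : fieldType) (n : nat).

(* The indices n+1 and n+2, and the index a for 1 <= a <= n. *)
Definition idx1 : 'I_(n + 2) := rshift n ord0.
Definition idx2 : 'I_(n + 2) := rshift n ord_max.
Definition idx (a : 'I_n) : 'I_(n + 2) := lshift 2 a.

Definition divisor_ideal : {pred cone_ring C (n + 2)} :=
  fun f => `[< exists g, f = g * cone_plucker C idx1 idx2 >].

Fact divisor_ideal_closed : idealr_closed divisor_ideal.
Proof.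
split.
- by apply/asboolP; exists 0; rewrite mul0r.
- apply/negP => /asboolP [g hg].
  pose D : bivector_poly C (n + 2) := plucker_poly C idx1 idx2.
  have D0 : D.@[fun=> 0] = 0.
    by rewrite /D /plucker_poly; case: insubP => [k _ _|_] /=;
      rewrite ?mevalXU ?meval0.
  have : (1 - repr g * D) \in @cone_ideal C (n + 2).
    rewrite Quotient.idealrBE; apply/eqP.
    rewrite rmorph1 rmorphM /= reprK; exact: hg.
  move=> /asboolP /(_ _ (decomposable0 C (n + 2))) /eqP.
  by rewrite mevalB mevalM D0 mulr0 subr0 meval1 oner_eq0.
- move=> a f g /asboolP [f' ->] /asboolP [g' ->]; apply/asboolP.
  by exists (a * f' + g'); rewrite mulrDl mulrA.
Qed.

HB.instance Definition _ :=
  isIdealr.Build (cone_ring C (n + 2)) divisor_ideal divisor_ideal_closed.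

(* C[X] = C[X_{n+2}] / <Delta_{n+1,n+2}> *)
Definition divisor_ring := {ideal_quot divisor_ideal}.
HB.instance Definition _ := GRing.ComNzRing.on divisor_ring.

Definition Delta (i j : 'I_(n + 2)) : divisor_ring :=
  (\pi_({ideal_quot divisor_ideal}) (cone_plucker C i j))%qT.

(* Z[X], as the subring of C[X] generated by the Plucker coordinates. *)
Definition divisor_Zform :=
  subring (fun y : divisor_ring => exists i j : 'I_(n + 2), (i < j)%N /\ y = Delta i j).
HB.instance Definition _ := GRing.ComNzRing.on divisor_Zform.

End Divisor.

Section Correspondence.
Variables (C : fieldType) (n : nat) (F : fieldType).
Variables (p : side_orbit n -> F) (s0 : seed n p) (x : label n -> F).
Variable phi : {rmorphism cluster_algebra s0 -> divisor_Zform C n}.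

Definition sends (y : F) (d : divisor_ring C n) : Prop :=
  exists2 u : cluster_algebra s0, subring_val u = y & subring_val (phi u) = d.

Definition extends_correspondence : Prop :=
  let elt := symbol_elt p x in
  let vx a : vertex n := lshift n a in
  let vxbar a : vertex n := rshift n a in
  [/\ forall a, sends (elt (plain (vx a) (vxbar a))) (Delta C (idx a) (idx1 n)),
      forall a, sends (elt (tilde (vx a))) (Delta C (idx a) (idx2 n)),
      forall a b : 'I_n, (a < b)%N ->
        sends (elt (plain (vx a) (vx b))) (Delta C (idx a) (idx b))
    & forall a b : 'I_n, (a < b)%N ->
        sends (elt (plain (vx a) (vxbar b)))
          (Delta C (idx a) (idx1 n) * Delta C (idx b) (idx2 n)
             - Delta C (idx a) (idx b))].

End Correspondence.

(* Main.v *)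
Require Import Defs.
From HB Require Import structures.
From mathcomp Require Import all_boot all_order all_algebra.
From mathcomp Require Import perm generic_quotient ring_quotient mpoly boolp.
From mathcomp Require Import complex reals.
From mathcomp Require Import ring zify.

Set Implicit Arguments.
Unset Strict Implicit.
Unset Printing Implicit Defensive.

Import Order.TTheory GRing.Theory Num.Theory.
Local Open Scope ring_scope.

(** Both rings are images of one polynomial ring over the integers, with a
    variable X_ij for each pair i < j among n + 2 indices: X_(a,n+1) goes to the
    first colour of the a-th diameter, X_(a,n+2) to its second colour, X_ab to
    the chord from a to b, and X_(n+1,n+2) to 0.  For a < b with antipodes A and
    B, and y the second colour, [special_exchange3] for a, b and for b, A reads
      x_aA y_bB = x_ab + x_aB = x_bB y_aA.
    This expresses the x_aB by the images of the X_ij, and once they are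
    eliminated, [special_exchange4] becomes the three-term Pluecker relation
    ([special_frame]).  It remains to see that the two kernels agree and that the
    two images are the rings of the theorem.

    Kernels.  Both are the kernel of the map to Z[u, v] that sends X_ij to
    u_i v_j - u_j v_i, where u vanishes at the last two indices: a generic point
    of the divisor.

    - On the divisor ([to_Zform_kernel]), a relation holds at the complex
      points, and these are Zariski dense in the affine space with coordinates
      u, v.  Conversely, straightening rewrites a polynomial modulo the relations
      of the divisor as a combination of standard monomials, those without
      nested pairs and without X_(n+1,n+2).  Their images have distinct leading
      monomials, so a standard combination in the kernel is 0.

    - In the ambient field ([frame_kernel]), the diameters of the first colour
      form a cluster, hence are algebraically independent over the field of
      coefficients, and together with the generators attached to the sides they
      are algebraically independent over Z.  The Pluecker relations alone express
      every coordinate through these 2n elements, up to a denominator which is a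
      monomial in the diameters ([clearable_poly]).  So a relation in the field
      gives a polynomial identity, which then holds at the generic point.
      Conversely, the coordinates in the field come from vectors u, v with
      entries in that field ([frame_realized]).

    Images ([special_cover]).  For adjacent vertices a, b the generator attached
    to the side from a to b is a coefficient of [special_exchange3], so all images
    of the X_ij lie in the cluster algebra.  In the other direction the point is
    that the coefficients of every seed are products of such generators.  This is
    read off from the exchange relations, provided that every seed can be mutated
    in every direction: the exchange matrices in a mutation class of type D_n are
    skew-symmetric, and for those the mutated seed can be written down
    ([mutation_exists]). *)

(** * Polynomials that vanish at every point *)

Lemma digits_inj d n (f g : nat -> nat) :
    (forall i, (i < n)%N -> (f i < d)%N) -> (forall i, (i < n)%N -> (g i < d)%N) ->
  (\sum_(i < n) f i * d ^ i = \sum_(i < n) g i * d ^ i)%N ->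
  forall i, (i < n)%N -> f i = g i.
Proof.
elim: n f g => [|n IHn] f g ltf ltg; first by [].
have tail (h : nat -> nat) :
    (\sum_(i < n.+1) h i * d ^ i
       = (\sum_(i < n) h i.+1 * d ^ i) * d + h 0)%N.
  rewrite big_ord_recl expn0 muln1 addnC; congr (_ + _)%N.
  by rewrite big_distrl; apply: eq_bigr => i _; rewrite /= expnSr mulnA.
rewrite !tail => eq_fg.
have d_gt0 : (0 < d)%N by apply: leq_trans (ltf 0%N _).
have eq0 : f 0%N = g 0%N.
  by have := congr1 (modn^~ d) eq_fg; rewrite !modnMDl !modn_small ?ltf ?ltg.
move=> [_|i lt_in]; first exact: eq0.
apply: (IHn (f \o succn) (g \o succn)) => [j ltj|j ltj||//] /=.
- exact: ltf.
- exact: ltg.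
by apply/eqP; rewrite -(eqn_pmul2r d_gt0); move/eqP: eq_fg; rewrite eq0 eqn_add2r.
Qed.

Section Vanishing.
Variables (K : idomainType) (char0 : forall m, m.+1%:R != 0 :> K).

Lemma natr_inj_char0 : injective (fun m : nat => m%:R : K).
Proof.
move=> a b; wlog le_ab : a b / (a <= b)%N => [sym eq_ab|/eqP eq_ab].
  by case/orP: (leq_total a b) => /sym; [apply|move=> <-].
move: eq_ab; rewrite eq_sym -subr_eq0 -natrB //; case E: (b - a)%N => [|c].
  by move=> _; lia.
by rewrite (negPf (char0 c)).
Qed.

Lemma poly_vanish (q : {poly K}) : (forall z, q.[z] = 0) -> q = 0.
Proof.
move=> q0; apply/eqP/negPn/negP => nz_q.
have := max_poly_roots nz_q (rs := [seq i%:R : K | i <- iota 0 (size q)]).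
rewrite size_map size_iota ltnn => contra; apply: notF; apply: contra.
  by apply/allP => z _; rewrite rootE q0.
by rewrite map_inj_uniq ?iota_uniq //; exact: natr_inj_char0.
Qed.

(** Kronecker substitution: putting z ^ (d ^ i) for the i-th variable, with d
    larger than the degree, sends distinct monomials of Q to distinct powers of
    z, and a polynomial in z has finitely many roots. *)
Lemma mpoly_vanish n (Q : {mpoly K[n]}) : (forall v, Q.@[v] = 0) -> Q = 0.
Proof.
move=> Q0; pose d := msize Q.
pose code (m : 'X_{1..n}) := (\sum_(i < n) m i * d ^ i)%N.
have meval_code z (m : 'X_{1..n}) :
    \prod_(i < n) (z ^+ (d ^ i)) ^+ m i = z ^+ code m :> K.
  by rewrite -prodrXr; apply: eq_bigr => i _; rewrite -exprM mulnC.
pose q : {poly K} := \sum_(m <- msupp Q) Q@_m *: 'X^(code m).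
have q0 : q = 0.
  apply: poly_vanish => z; rewrite -(Q0 (fun i : 'I_n => z ^+ (d ^ i))) mevalE.
  by rewrite horner_sum; apply: eq_bigr => m _; rewrite hornerZ hornerXn meval_code.
have code_inj : {in msupp Q &, injective code}.
  move=> m1 m2 Qm1 Qm2 eq_code; apply/mnmP => i.
  have bnd m j : m \in msupp Q -> (m (j : 'I_n) < d)%N.
    move/msize_mdeg_lt; apply: leq_ltn_trans.
    by rewrite mdegE (bigD1 j) //= leq_addr.
  (* The exponents, extended by 0 to all natural indices. *)
  pose dig (m : 'X_{1..n}) j := if insub j is Some k then m (k : 'I_n) else 0%N.
  have digE m (j : 'I_n) : dig m j = m j by rewrite /dig valK.
  rewrite -!digE; apply: (@digits_inj d n); rewrite ?ltn_ord //.
  - by move=> j ltj; have := digE m1 (Ordinal ltj) => /= ->; exact: bnd.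
  - by move=> j ltj; have := digE m2 (Ordinal ltj) => /= ->; exact: bnd.
  by under eq_bigr do rewrite digE; under [RHS]eq_bigr do rewrite digE.
apply/mpolyP => m; rewrite mcoeff0; case: (boolP (m \in msupp Q)); last first.
  exact: memN_msupp_eq0.
move=> Qm; have := congr1 (fun r : {poly K} => r`_(code m)) q0.
rewrite coef0 coef_sum (bigD1_seq m) //= ?msupp_uniq //.
rewrite coefZ coefXn eqxx mulr1 big_seq_cond big1 ?addr0 //.
move=> m' /andP[Qm' ne_m]; rewrite coefZ coefXn; case: eqP => [/code_inj E|].
  by rewrite E ?eqxx // in ne_m.
by rewrite mulr0.
Qed.

End Vanishing.

(** * Subrings that are images of the same ring *)

Section CommonCover.
Variables (P A B : comNzRingType) (alpha : {rmorphism P -> A}).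
Variables (beta : {rmorphism P -> B}) (S : A -> Prop) (T : B -> Prop).
Hypothesis alpha_cover : forall y, in_subring S y <-> exists q, y = alpha q.
Hypothesis beta_cover : forall y, in_subring T y <-> exists q, y = beta q.
Hypothesis same_kernel : forall q, alpha q = 0 <-> beta q = 0.

Lemma cover_lift (u : subring S) : exists q, subring_val u = alpha q.
Proof. by apply/alpha_cover; case: u => y /= /asboolP. Qed.

Let lift u : P := sval (cid (cover_lift u)).

Let liftP u : subring_val u = alpha (lift u) := svalP (cid (cover_lift u)).

Fact cover_iso_subproof u : beta (lift u) \in subring_pred T.
Proof. by apply/asboolP/beta_cover; exists (lift u). Qed.

Definition cover_iso u : subring T := Subring (cover_iso_subproof u).

Lemma cover_isoP u q : subring_val u = alpha q ->
  subring_val (cover_iso u) = beta q.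
Proof.
rewrite liftP /= => eq_q; apply/eqP; rewrite -subr_eq0 -rmorphB; apply/eqP.
by apply/same_kernel; rewrite rmorphB eq_q subrr.
Qed.

Fact cover_iso_zmod_morphism : zmod_morphism cover_iso.
Proof.
move=> u v; apply: val_inj; rewrite /= -rmorphB.
by apply: cover_isoP; rewrite rmorphB -!liftP.
Qed.

Fact cover_iso_monoid_morphism : monoid_morphism cover_iso.
Proof.
split=> [|u v]; apply: val_inj; rewrite /=.
  by rewrite -(rmorph1 beta); apply: cover_isoP; rewrite rmorph1.
by rewrite -rmorphM; apply: cover_isoP; rewrite rmorphM -!liftP.
Qed.

HB.instance Definition _ := GRing.isZmodMorphism.Build (subring S) (subring T)
  cover_iso cover_iso_zmod_morphism.
HB.instance Definition _ := GRing.isMonoidMorphism.Build (subring S) (subring T)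
  cover_iso cover_iso_monoid_morphism.

Lemma cover_iso_inj : injective cover_iso.
Proof.
move=> u v eq_uv; apply: val_inj; rewrite /= !liftP; apply/eqP.
rewrite -subr_eq0 -rmorphB; apply/eqP/same_kernel.
by rewrite rmorphB; have /= -> := congr1 (@subring_val _ _) eq_uv; rewrite subrr.
Qed.

Lemma cover_iso_surj w : exists u, cover_iso u = w.
Proof.
have [q eq_q] : exists q, subring_val w = beta q.
  by apply/beta_cover; case: w => y /= /asboolP.
have Sq : alpha q \in subring_pred S by apply/asboolP/alpha_cover; exists q.
by exists (Subring Sq); apply: val_inj; rewrite [RHS]eq_q; exact: cover_isoP.
Qed.

Fact corestrict_subproof q : alpha q \in subring_pred S.
Proof. by apply/asboolP/alpha_cover; exists q. Qed.

Definition corestrict q : subring S := Subring (corestrict_subproof q).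

Fact corestrict_zmod_morphism : zmod_morphism corestrict.
Proof. by move=> q r; apply: val_inj; rewrite /= rmorphB. Qed.

Fact corestrict_monoid_morphism : monoid_morphism corestrict.
Proof. by split=> [|q r]; apply: val_inj; rewrite /= ?rmorph1 ?rmorphM. Qed.

HB.instance Definition _ := GRing.isZmodMorphism.Build P (subring S)
  corestrict corestrict_zmod_morphism.
HB.instance Definition _ := GRing.isMonoidMorphism.Build P (subring S)
  corestrict corestrict_monoid_morphism.

Lemma corestrict_surj u : exists q, u = corestrict q.
Proof. by have [q uE] := cover_lift u; exists q; apply: val_inj. Qed.

Lemma cover_isomorphism : exists phi : {rmorphism subring S -> subring T},
  bijective phi /\
  forall u q, subring_val u = alpha q -> subring_val (phi u) = beta q.
Proof.
exists cover_iso; split; last exact: cover_isoP.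
pose g w := sval (cid (cover_iso_surj w)).
have gK : cancel g cover_iso by move=> w; exact: (svalP (cid (cover_iso_surj w))).
by exists g => // u; apply: cover_iso_inj; rewrite gK.
Qed.

End CommonCover.

(** * Pluecker coordinates *)

Section Plucker.
Variable m : nat.
Local Notation N := #|plucker_index m|.

Definition fst_idx (k : 'I_N) : 'I_m := (val (enum_val k)).1.
Definition snd_idx (k : 'I_N) : 'I_m := (val (enum_val k)).2.

Lemma fst_lt_snd k : (fst_idx k < snd_idx k)%N.
Proof. exact: (valP (enum_val k)). Qed.

Definition pair_idx (i j : 'I_m) (lt_ij : (i < j)%N) : 'I_N :=
  enum_rank (Sub (i, j) lt_ij : plucker_index m).

Lemma fst_pair_idx i j lt_ij : fst_idx (@pair_idx i j lt_ij) = i.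
Proof. by rewrite /fst_idx enum_rankK. Qed.

Lemma snd_pair_idx i j lt_ij : snd_idx (@pair_idx i j lt_ij) = j.
Proof. by rewrite /snd_idx enum_rankK. Qed.

Lemma pair_idx_inj (k l : 'I_N) :
  fst_idx k = fst_idx l -> snd_idx k = snd_idx l -> k = l.
Proof.
rewrite /fst_idx /snd_idx => eq1 eq2; apply/enum_val_inj/val_inj.
by move: eq1 eq2; case: (val _) => a b; case: (val _) => c d /= -> ->.
Qed.

Definition wedge (R : comNzRingType) (u v : 'I_m -> R) (k : 'I_N) : R :=
  u (fst_idx k) * v (snd_idx k) - u (snd_idx k) * v (fst_idx k).

Lemma rmorph_wedge (R S : comNzRingType) (f : {rmorphism R -> S}) u v k :
  f (wedge u v k) = wedge (f \o u) (f \o v) k.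
Proof. by rewrite /wedge rmorphB !rmorphM. Qed.

Lemma wedge_pair_idx (R : comNzRingType) (u v : 'I_m -> R) i j lt_ij :
  wedge u v (@pair_idx i j lt_ij) = u i * v j - u j * v i.
Proof. by rewrite /wedge fst_pair_idx snd_pair_idx. Qed.

Lemma plucker_polyE (C : fieldType) (i j : 'I_m) (lt_ij : (i < j)%N) :
  plucker_poly C i j = 'X_(pair_idx lt_ij).
Proof. by rewrite /plucker_poly insubT. Qed.

Lemma plucker_poly_idx (C : fieldType) (k : 'I_N) :
  'X_k = plucker_poly C (fst_idx k) (snd_idx k).
Proof.
rewrite (plucker_polyE C (fst_lt_snd k)); congr 'X_(_).
by apply: pair_idx_inj; rewrite ?fst_pair_idx ?snd_pair_idx.
Qed.

Lemma decomposable_wedge (C : fieldType) (u v : 'I_m -> C) :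
  decomposable (wedge u v).
Proof.
exists (\row_i u i), (\row_i v i) => k.
by rewrite /wedge /fst_idx /snd_idx enum_rankK; case: (val k) => i j; rewrite !mxE.
Qed.

Lemma decomposableE (C : fieldType) (w : bivector C m) :
  decomposable w -> exists u v, w =1 wedge u v.
Proof.
case=> u [v uvP]; exists (u 0), (v 0) => k; have := uvP (enum_val k).
by rewrite enum_valK /wedge /fst_idx /snd_idx; case: (val _).
Qed.

(** Nested pairs are the obstruction to being standard: the two-row tableau with
    columns k and l then has a decreasing second row when its first row is
    sorted. *)
Definition nested (k l : 'I_N) : bool :=
  (fst_idx k < fst_idx l)%N && (snd_idx l < snd_idx k)%N.

(** The measure that makes straightening terminate.  Uncrossing a nested pair
    gives two pairs whose lengths have the same sum but are less unequal, or two
    pairs that together are shorter than the outer one; in both cases the sum of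
    the squares of the lengths drops. *)
Definition spread (e : 'X_{1..N}) : nat :=
  (\sum_k e k * (snd_idx k - fst_idx k) ^ 2)%N.

Lemma spreadD e1 e2 : spread (e1 + e2) = (spread e1 + spread e2)%N.
Proof. by rewrite -big_split; apply: eq_bigr => k _; rewrite mnmDE mulnDl. Qed.

Lemma spreadU k : spread U_(k) = ((snd_idx k - fst_idx k) ^ 2)%N.
Proof.
rewrite /spread (bigD1 k) //= mnm1E eqxx mul1n big1 ?addn0 // => l ne_lk.
by rewrite mnm1E eq_sym (negPf ne_lk) mul0n.
Qed.

Lemma uncross k l : nested k l -> exists k1 l1 k2 l2 : 'I_N,
  [/\ (spread (U_(k1) + U_(l1)) < spread (U_(k) + U_(l)))%N,
      (spread (U_(k2) + U_(l2)) < spread (U_(k) + U_(l)))%N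
    & forall (R : comNzRingType) (u v : 'I_m -> R),
      wedge u v k * wedge u v l
        = wedge u v k1 * wedge u v l1 - wedge u v k2 * wedge u v l2].
Proof.
case/andP=> lt1 lt2; have lt_l := fst_lt_snd l.
have lt_ad : (fst_idx k < snd_idx l)%N by exact: ltn_trans lt1 lt_l.
have lt_cb : (fst_idx l < snd_idx k)%N by exact: ltn_trans lt_l lt2.
exists (pair_idx lt_ad), (pair_idx lt_cb), (pair_idx lt1), (pair_idx lt2).
rewrite !spreadD !spreadU !fst_pair_idx !snd_pair_idx; split; [nia|nia|].
by move=> R u v; rewrite !wedge_pair_idx /wedge; ring.
Qed.

End Plucker.

(** * Straightening on the divisor *)

Section IdealProjection.
Variables (A : comNzRingType) (I : idealr A).

Definition ideal_proj (x : A) : {ideal_quot I} := (\pi_({ideal_quot I}) x)%qT.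

Fact ideal_proj_zmod_morphism : zmod_morphism ideal_proj.
Proof. exact: rmorphB. Qed.

Fact ideal_proj_monoid_morphism : monoid_morphism ideal_proj.
Proof. by split; [exact: rmorph1|exact: rmorphM]. Qed.

HB.instance Definition _ := GRing.isZmodMorphism.Build A {ideal_quot I}
  ideal_proj ideal_proj_zmod_morphism.
HB.instance Definition _ := GRing.isMonoidMorphism.Build A {ideal_quot I}
  ideal_proj ideal_proj_monoid_morphism.

Lemma ideal_proj_eq0 x : ideal_proj x = 0 <-> x \in I.
Proof.
rewrite -[X in X \in I]subr0 Quotient.idealrBE (rmorph0 (\pi_({ideal_quot I}))%qT).
by split=> [xE|/eqP xE]; [apply/eqP|].
Qed.

Lemma ideal_proj_surj z : exists x, z = ideal_proj x.
Proof. by exists (repr z); rewrite /ideal_proj reprK. Qed.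

End IdealProjection.

Section DivisorRelations.
Variables (C : fieldType) (n : nat).
Hypothesis char0 : forall m, m.+1%:R != 0 :> C.
Local Notation m := (n + 2)%N.
Local Notation N := #|plucker_index m|.

Lemma lt_idx12 : (idx1 n < idx2 n)%N.
Proof. by rewrite /= ltn_add2l. Qed.

Definition cut_idx : 'I_N := pair_idx lt_idx12.

Definition to_cone : {rmorphism bivector_poly C m -> cone_ring C m} :=
  ideal_proj (@cone_ideal C m).

Definition of_cone : {rmorphism cone_ring C m -> divisor_ring C n} :=
  ideal_proj (@divisor_ideal C n).

Definition to_divisor : {rmorphism bivector_poly C m -> divisor_ring C n} :=
  of_cone \o to_cone.

Lemma to_divisorX k : to_divisor 'X_k = Delta C (fst_idx k) (snd_idx k).
Proof. by rewrite plucker_poly_idx. Qed.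

Lemma to_cone_eq0 f : to_cone f = 0 <-> forall u v : 'I_m -> C, f.@[wedge u v] = 0.
Proof.
split=> [/ideal_proj_eq0/asboolP f0 u v|f0]; first exact/f0/decomposable_wedge.
apply/ideal_proj_eq0/asboolP => w /decomposableE[u [v uvE]].
by rewrite (meval_eq _ uvE).
Qed.

(** The ideal of the cone consists of all polynomials that vanish on decomposable
    bivectors, so identities in the ring of the divisor can be checked on
    coordinates of wedges. *)
Lemma to_divisor_eq f g : (forall u v : 'I_m -> C, f.@[wedge u v] = g.@[wedge u v]) ->
  to_divisor f = to_divisor g.
Proof.
move=> eq_fg; apply/eqP; rewrite -subr_eq0 -rmorphB /=; apply/eqP.
suff -> : to_cone (f - g) = 0 by rewrite rmorph0.
by apply/to_cone_eq0 => u v; rewrite mevalB eq_fg subrr.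
Qed.

Lemma to_divisor_eq0 f :
  to_divisor f = 0 <-> exists g, to_cone f = to_cone (g * 'X_cut_idx).
Proof.
have cutE : cone_plucker C (idx1 n) (idx2 n) = to_cone 'X_cut_idx.
  by rewrite -(plucker_polyE C lt_idx12).
split=> [/ideal_proj_eq0/asboolP[g]|[g fE]].
  by have [h ->] := ideal_proj_surj g; rewrite cutE => fE; exists h; rewrite rmorphM.
apply/ideal_proj_eq0/asboolP; exists (to_cone g).
by rewrite [LHS]fE rmorphM cutE.
Qed.

Lemma to_divisor_cut : to_divisor 'X_cut_idx = 0.
Proof. by apply/to_divisor_eq0; exists 1; rewrite mul1r. Qed.

Lemma to_divisor_eval f (u v : 'I_m -> C) :
  to_divisor f = 0 -> wedge u v cut_idx = 0 -> f.@[wedge u v] = 0.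
Proof.
case/to_divisor_eq0=> g /eqP; rewrite -subr_eq0 -rmorphB => /eqP/to_cone_eq0 fE cut0.
have /eqP := fE u v; rewrite mevalB mevalM mevalXU cut0 mulr0 subr0.
by move/eqP.
Qed.

Section Generic.
Variable R : comNzRingType.

(** A generic point of the divisor: u vanishes at the last two indices, hence so
    does the last coordinate of the wedge.  The u come before the v in the list of
    variables; this makes u_i v_j the leading term of u_i v_j - u_j v_i for
    i < j. *)
Definition gen_u (i : 'I_m) : {mpoly R[m + m]} :=
  if (i < n)%N then 'X_(lshift m i) else 0.
Definition gen_v (i : 'I_m) : {mpoly R[m + m]} := 'X_(rshift m i).

End Generic.

Local Notation theta := (mmap (@mpolyC (m + m) C) (wedge (@gen_u C) (@gen_v C))).

Lemma theta_eval f x :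
  (theta f).@[x] = f.@[wedge (fun i => (gen_u C i).@[x]) (fun i => (gen_v C i).@[x])].
Proof.
elim/mpolyind: f => [|c e f _ _ IHf]; first by rewrite rmorph0 !meval0.
rewrite mmapD !mevalD IHf; congr (_ + _).
rewrite mmapZ mmapX mevalM mevalC mevalZ mevalX; congr (_ * _).
rewrite /mmap1 rmorph_prod; apply: eq_bigr => k _.
by rewrite rmorphXn (rmorph_wedge (meval x)).
Qed.

Lemma theta_eq0_of_divisor f : to_divisor f = 0 -> theta f = 0.
Proof.
move=> f0; apply: mpoly_vanish => // x; rewrite theta_eval; apply: to_divisor_eval => //.
by rewrite wedge_pair_idx /gen_u /= ltnNge leq_addr /= ltnNge leq_addr /= meval0 !mul0r subrr.
Qed.

Definition standard (e : 'X_{1..N}) : bool :=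
  (e cut_idx == 0%N) &&
  [forall k, forall l, (e k != 0%N) && (e l != 0%N) ==> ~~ nested k l].

(** A monomial that contains X_(n+1,n+2) vanishes on the divisor, and one with a
    nested pair is rewritten by the Pluecker relation into two monomials of
    smaller spread. *)
Lemma straighten_monomial (e : 'X_{1..N}) : exists f : bivector_poly C m,
  {in msupp f, forall e', standard e'} /\ to_divisor 'X_[e] = to_divisor f.
Proof.
have [s] := ubnP (spread e); elim: s e => // s IHs e le_s.
have XU (e' : 'X_{1..N}) k : e' k != 0%N -> e' = (U_(k) + (e' - U_(k)))%MM.
  by move=> nz; rewrite addmC submK // lep1mP.
have [/eqP cut0|/XU cutE] := boolP (e cut_idx == 0%N); last first.
  exists 0; split=> [e'|]; first by rewrite msupp0.
  by rewrite cutE mpolyXD rmorphM to_divisor_cut mul0r rmorph0.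
have [std|] := boolP (standard e).
  by exists 'X_[e]; split=> // e'; rewrite msuppX inE => /eqP ->.
rewrite /standard cut0 eqxx => /forallPn[k /forallPn[l]].
rewrite negb_imply negbK => /andP[/andP[ek el] nest].
have ne_kl : l != k by apply: contraTneq nest => ->; rewrite /nested ltnn.
have [k1 [l1 [k2 [l2 [lt1 lt2 relE]]]]] := uncross nest.
pose r := (e - U_(k) - U_(l))%MM.
have eE : e = (U_(k) + U_(l) + r)%MM.
  rewrite {1}(XU _ _ ek) -addmA; congr (_ + _)%MM; apply: XU.
  by rewrite mnmBE mnm1E [k == l]eq_sym (negPf ne_kl) subn0.
have bnd k' l' : (spread (U_(k') + U_(l')) < spread (U_(k) + U_(l)))%N ->
    (spread (U_(k') + U_(l') + r)%MM < s)%N.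
  by move=> lt; move: le_s; rewrite eE !(spreadD _ r); lia.
have [f1 [std1 E1]] := IHs _ (bnd _ _ lt1).
have [f2 [std2 E2]] := IHs _ (bnd _ _ lt2).
exists (f1 - f2); split=> [e' /msuppB_le|].
  by rewrite mem_cat => /orP[/std1|/std2].
rewrite rmorphB -E1 -E2 -rmorphB; apply: to_divisor_eq => u v.
by rewrite eE !mpolyXD mevalB !mevalM !mevalXU relE mulrBl.
Qed.

Lemma straighten (f : bivector_poly C m) : exists g : bivector_poly C m,
  {in msupp g, forall e, standard e} /\ to_divisor f = to_divisor g.
Proof.
elim/mpolyind: f => [|c e f _ _ [g [stdg Eg]]].
  by exists 0; split=> // e; rewrite msupp0.
have [h [stdh Eh]] := straighten_monomial e.
exists (c *: h + g); split=> [e' /msuppD_le|].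
  by rewrite mem_cat => /orP[/msuppZ_le/stdh|/stdg].
by rewrite !rmorphD Eg -!mul_mpolyC !rmorphM Eh.
Qed.

(** The leading monomial of the image of a standard monomial: it records the
    multiset of first indices and the multiset of second indices. *)
Definition content (e : 'X_{1..N}) : 'X_{1..m + m} :=
  (\sum_k (U_(lshift m (fst_idx k)) + U_(rshift m (snd_idx k))) *+ e k)%MM.

Lemma content_lshift (e : 'X_{1..N}) i :
  content e (lshift m i) = (\sum_k e k * (fst_idx k == i))%N.
Proof.
rewrite /content mnm_sumE; apply: eq_bigr => k _.
by rewrite mulmnE mnmDE !mnm1E eq_lshift eq_rlshift addn0 mulnC.
Qed.

Lemma content_rshift (e : 'X_{1..N}) j :
  content e (rshift m j) = (\sum_k e k * (snd_idx k == j))%N.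
Proof.
rewrite /content mnm_sumE; apply: eq_bigr => k _.
by rewrite mulmnE mnmDE !mnm1E eq_rshift eq_lrshift add0n mulnC.
Qed.

Lemma contentD e1 e2 : content (e1 + e2) = (content e1 + content e2)%MM.
Proof.
apply/mnmP => i; rewrite mnmDE; case: (splitP i) => j Ej.
  have -> : i = lshift m j by apply: val_inj.
  by rewrite !content_lshift -big_split; apply: eq_bigr => k _; rewrite mnmDE mulnDl.
have -> : i = rshift m j by apply: val_inj.
by rewrite !content_rshift -big_split; apply: eq_bigr => k _; rewrite mnmDE mulnDl.
Qed.

Lemma content_supp (e : 'X_{1..N}) k : e k != 0%N ->
  content e (lshift m (fst_idx k)) != 0%N /\ content e (rshift m (snd_idx k)) != 0%N.
Proof.
move=> nz; rewrite content_lshift content_rshift; split; rewrite (bigD1 k) //= eqxx;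
  by rewrite muln1 addn_eq0 negb_and nz.
Qed.

Lemma fiber_sum_neq0 (I : finType) (T : eqType) (w : I -> nat) (f : I -> T) y :
  (\sum_i w i * (f i == y) != 0)%N -> exists2 i, w i != 0%N & f i = y.
Proof.
move=> nz; have [i /andP[wi /eqP fi]|none] := pickP (fun i => (w i != 0%N) && (f i == y)).
  by exists i.
case/negP: nz; rewrite big1 // => i _.
by have := none i; case: (w i) => //= k ->; rewrite muln0.
Qed.

(** In a standard monomial, the pair with the smallest first index can be chosen
    to have the smallest second index as well, since otherwise two of its pairs
    would be nested. *)
Lemma corner (e : 'X_{1..N}) k0 : standard e -> e k0 != 0%N -> exists k, [/\ e k != 0%N,
  forall i, content e (lshift m i) != 0%N -> (fst_idx k <= i)%N
  & forall j, content e (rshift m j) != 0%N -> (snd_idx k <= j)%N].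
Proof.
case/andP=> _ /forallP std ek0.
case: (arg_minnP (P := fun k => e k != 0%N)
  (fun k : 'I_N => fst_idx k * m + snd_idx k)%N ek0) => k ek min_k.
have min1 l : e l != 0%N -> (fst_idx k <= fst_idx l)%N.
  move/min_k; have := ltn_ord (snd_idx k); have := ltn_ord (snd_idx l); nia.
exists k; split=> // [i|j].
  by rewrite content_lshift => /fiber_sum_neq0[l el <-]; exact: min1.
rewrite content_rshift => /fiber_sum_neq0[l el <-].
have /forallP/(_ l) := std k; rewrite ek el /nested negb_and -!leqNgt /=.
have := min_k _ el; have := min1 _ el.
have := ltn_ord (snd_idx k); have := ltn_ord (snd_idx l).
nia.
Qed.

Lemma standard_sub (e : 'X_{1..N}) k : standard e -> standard (e - U_(k)).
Proof.
case/andP=> /eqP e0 /forallP std; rewrite /standard mnmBE e0 sub0n eqxx /=.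
have sub c : (e - U_(k))%MM c != 0%N -> e c != 0%N by rewrite mnmBE; case: (e c).
apply/forallP => a; apply/forallP => b; apply/implyP => /andP[/sub ea /sub eb].
by have /forallP/(_ b)/implyP := std a; apply; rewrite ea.
Qed.

(** A standard monomial is recovered from its content by removing its corner,
    which is determined by the content, again and again. *)
Lemma content_inj e1 e2 : standard e1 -> standard e2 -> content e1 = content e2 -> e1 = e2.
Proof.
have [d] := ubnP (mdeg e1 + mdeg e2); elim: d e1 e2 => // d IHd e1 e2 le_d s1 s2 eq_sh.
have zero e : content e = 0%MM -> e = 0%MM.
  move=> sh0; apply/mnmP => k; rewrite mnm0E; apply/eqP; apply: contraT => /content_supp[].
  by rewrite sh0 mnm0E.
have nzP (e : 'X_{1..N}) : e != 0%MM -> exists k, e k != 0%N.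
  move=> nz; apply/existsP; apply: contraR nz => /existsPn e0; apply/eqP/mnmP => k.
  by rewrite mnm0E; apply/eqP; rewrite -[_ == _]negbK e0.
have [z1|/nzP[k1' ek1']] := eqVneq e1 0%MM.
  rewrite z1; apply/esym/zero; rewrite -eq_sh z1; apply/mnmP => i; rewrite mnm0E /content.
  by rewrite mnm_sumE big1 // => k _; rewrite mulmnE mnm0E muln0.
have [z2|/nzP[k2' ek2']] := eqVneq e2 0%MM.
  rewrite z2; apply/zero; rewrite eq_sh z2; apply/mnmP => i; rewrite mnm0E /content.
  by rewrite mnm_sumE big1 // => k _; rewrite mulmnE mnm0E muln0.
have [k1 [ek1 min1 min1']] := corner s1 ek1'.
have [k2 [ek2 min2 min2']] := corner s2 ek2'.
have [a1 b1] := content_supp ek1; have [a2 b2] := content_supp ek2.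
have Ek : k1 = k2.
  apply: pair_idx_inj; apply: val_inj; apply/eqP; rewrite eqn_leq.
    by rewrite min1 ?eq_sh // min2 // -eq_sh.
  by rewrite min1' ?eq_sh // min2' // -eq_sh.
rewrite -{}Ek in ek2.
have eE (e : 'X_{1..N}) : e k1 != 0%N -> e = (e - U_(k1) + U_(k1))%MM.
  by move=> nz; rewrite submK // lep1mP.
rewrite (eE _ ek1) (eE _ ek2); congr (_ + _)%MM; apply: IHd.
- move: le_d; rewrite {1}(eE _ ek1) {1}(eE _ ek2) !(mdegD _ U_(k1)) mdeg1; lia.
- exact: standard_sub.
- exact: standard_sub.
by apply: (@addIm _ (content U_(k1))); rewrite -!contentD -!eE.
Qed.

Lemma mlead_wedge k : k != cut_idx ->
  wedge (@gen_u C) (@gen_v C) k != 0 /\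
  mlead (wedge (@gen_u C) (@gen_v C) k)
    = (U_(lshift m (fst_idx k)) + U_(rshift m (snd_idx k)))%MM.
Proof.
move=> ne_k; have lt_k := fst_lt_snd k.
have lt_n : (fst_idx k < n)%N.
  rewrite ltnNge; apply: contra ne_k => le_n; apply/eqP.
  have := ltn_ord (snd_idx k) => lt_m.
  by apply: pair_idx_inj; rewrite ?fst_pair_idx ?snd_pair_idx; apply: val_inj => /=; lia.
have lead : mlead (wedge (@gen_u C) (@gen_v C) k)
    = (U_(lshift m (fst_idx k)) + U_(rshift m (snd_idx k)))%MM.
  rewrite /wedge /gen_u lt_n /gen_v -mpolyXD; case: ifP => _; last first.
    by rewrite mul0r subr0 mleadXm.
  rewrite -mpolyXD mleadDl ?mleadN ?mleadXm //.
  apply/ltmcP; first by rewrite !mdegD !mdeg1.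
  exists (lshift m (fst_idx k)) => [j lt_j|].
    rewrite !mnmDE !mnm1E -!val_eqE /=.
    by move: lt_j => /=; have := ltn_ord (fst_idx k); lia.
  rewrite !mnmDE !mnm1E eqxx eq_lshift !eq_rlshift -val_eqE /=.
  by rewrite gtn_eqF.
split=> //; apply/eqP => z; move: lead; rewrite z mlead0 => /mnmP/(_ (lshift m (fst_idx k))).
by rewrite mnm0E mnmDE !mnm1E eqxx.
Qed.

Lemma mlead_theta e : standard e -> theta 'X_[e] != 0 /\ mlead (theta 'X_[e]) = content e.
Proof.
case/andP=> /eqP e0 _.
have -> : theta 'X_[e] = \prod_k (wedge (@gen_u C) (@gen_v C) k) ^+ e k.
  by rewrite mmapX.
have nz k : wedge (@gen_u C) (@gen_v C) k ^+ e k != 0.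
  have [->|ne_k] := eqVneq k cut_idx; first by rewrite e0 expr0 oner_neq0.
  by rewrite expf_neq0 //; case: (mlead_wedge ne_k).
split; first by apply/prodf_neq0 => k _.
rewrite mlead_prod //; apply: eq_bigr => k _.
have [->|ne_k] := eqVneq k cut_idx; first by rewrite e0 expr0 mlead1 mulm0n.
by have [nz_w lead] := mlead_wedge ne_k; rewrite mleadX // lead.
Qed.

(** The leading monomials of the images of standard monomials are their contents,
    hence distinct, so the largest of them cannot cancel. *)
Lemma standard_free (g : bivector_poly C m) :
  {in msupp g, forall e, standard e} -> theta g = 0 -> g = 0.
Proof.
move=> std th0; apply/eqP/negPn/negP => nz_g.
have [e0 ge0] : exists e0, e0 \in msupp g.
  by exists (mlead g); apply: mlead_supp.
case: (@arg_maxP _ _ (seq_sub (msupp g)) (SeqSub ge0) xpredT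
         (fun e => content (val e)) isT) => [[e ge] _ max_e].
have := congr1 (mcoeff (content e)) th0; rewrite mcoeff0 (mpolyE g).
rewrite rmorph_sum /= raddf_sum /= (bigD1_seq e) //=; last exact: msupp_uniq.
rewrite [X in _ + X]big_seq_cond big1 ?addr0 => [|e' /andP[ge' ne_e']].
  have [nz lead] := mlead_theta (std _ ge).
  rewrite mmapZ mcoeffCM => /eqP; rewrite mulf_eq0 mcoeff_eq0 ge /=.
  by rewrite -lead mleadc_eq0; apply/negP: nz.
rewrite mmapZ mcoeffCM.
have [_ lead] := mlead_theta (std _ ge').
rewrite (mcoeff_gt_mlead (p := mmap _ _ 'X_[e'])) ?mulr0 // [mlead _]lead.
have le_e' : (content e' <= content e)%O := max_e (SeqSub ge') isT.
rewrite lt_neqAle le_e' andbT.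
by apply: contra ne_e' => /eqP/content_inj-> //; apply: std.
Qed.

Lemma divisor_eq0_of_theta f : theta f = 0 -> to_divisor f = 0.
Proof.
move=> th0; have [g [std eq_fg]] := straighten f.
rewrite eq_fg (standard_free std) ?rmorph0 //.
have : to_divisor (f - g) = 0 by rewrite rmorphB eq_fg subrr.
by move/theta_eq0_of_divisor; rewrite rmorphB /= th0 sub0r => /eqP; rewrite oppr_eq0 => /eqP.
Qed.

End DivisorRelations.

(** * Coordinates in terms of diameters and sides *)

Section Coordinates.
Variables (n : nat) (n_gt1 : (1 < n)%N).
Local Notation m := (n + 2)%N.
Local Notation N := #|plucker_index m|.

Definition first_idx : 'I_n := Ordinal (ltnW n_gt1).
Fact last_idx_subproof : (n.-1 < n)%N.
Proof. by lia. Qed.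

Definition last_idx : 'I_n := Ordinal last_idx_subproof.

Lemma first_lt_last : (first_idx < last_idx)%N.
Proof. by rewrite /=; lia. Qed.

Section Frame.
Variables (R : comNzRingType) (Y Z : 'I_n -> R) (D : 'I_n -> 'I_n -> R).

(** The Pluecker relations with the index n + 1, and those with both n + 1 and
    n + 2, as they read on the divisor: Y a, Z a and D a b stand for the
    coordinates of index (a, n+1), (a, n+2) and (a, b). *)
Record frame : Prop := {
  frame_prop : forall a b, Y a * Z b = Y b * Z a;
  frame_plucker : forall a b c : 'I_n, (a < b)%N -> (b < c)%N ->
    Y a * D b c + Y c * D a b = Y b * D a c }.

Definition coords (k : 'I_N) : R :=
  match split (fst_idx k), split (snd_idx k) with
  | inl a, inl b => D a b
  | inl a, inr c => if c == ord0 then Y a else Z a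
  | _, _ => 0
  end.

(** The elements which correspond to the n pairs of opposite sides of the
    polygon.  The last one is the side from n to the antipode of 1. *)
Definition rim (a : 'I_n) : R :=
  if insub a.+1 is Some b then D a b
  else Y first_idx * Z last_idx - D first_idx last_idx.

End Frame.

Definition int_eval (R : comNzRingType) (h : 'I_N -> R) (Q : {mpoly int[N]}) : R :=
  mmap intr h Q.

(** Polynomials in the diameters whose coefficients are polynomials in the sides:
    this nesting matches the independence of a cluster over the coefficient
    field. *)
Definition rim_poly := {mpoly {mpoly int[n]}[n]}.

Definition rim_eval (R : comNzRingType) (Y p : 'I_n -> R) (H : rim_poly) : R :=
  mmap (mmap (intr : int -> R) p) Y H.

Section RimEval.
Variables (R : comNzRingType) (Y p : 'I_n -> R).
Local Notation ev := (rim_eval Y p).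

Lemma rim_eval0 : ev 0 = 0. Proof. exact: rmorph0. Qed.
Lemma rim_evalD H1 H2 : ev (H1 + H2) = ev H1 + ev H2. Proof. exact: rmorphD. Qed.
Lemma rim_evalM H1 H2 : ev (H1 * H2) = ev H1 * ev H2. Proof. exact: rmorphM. Qed.
Lemma rim_evalX H e : ev (H ^+ e) = ev H ^+ e. Proof. exact: rmorphXn. Qed.
Lemma rim_eval_int c : ev c%:~R = c%:~R. Proof. exact: rmorph_int. Qed.
Lemma rim_eval_var a : ev 'X_a = Y a.
Proof. by rewrite /rim_eval mmapX mmap1U. Qed.
Lemma rim_eval_rim a : ev ('X_a)%:MP = p a.
Proof. by rewrite /rim_eval mmapC /= mmapX mmap1U. Qed.
Lemma rim_eval_prod P : ev (\prod_(a | P a) 'X_a) = \prod_(a | P a) Y a.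
Proof.
by rewrite /rim_eval rmorph_prod; apply: eq_bigr => a _; exact: rim_eval_var.
Qed.

End RimEval.

(** An expression in the coordinates is clearable when a power of the product of
    all Y a turns it into a polynomial in the Y a and the rim elements, the same
    polynomial for all frames over all rings. *)
Definition clearable (f : forall R : comNzRingType,
    ('I_n -> R) -> ('I_n -> R) -> ('I_n -> 'I_n -> R) -> R) : Prop :=
  exists e (H : rim_poly), forall (R : comNzRingType) Y Z D, @frame R Y Z D ->
    (\prod_a Y a) ^+ e * f R Y Z D = rim_eval Y (rim Y Z D) H.

(** Induction on b - a, peeling off the triangle b-1, b: the relation
    Y_(b-1) D_ab = Y_a D_(b-1,b) + Y_b D_(a,b-1) has the rim element D_(b-1,b) as
    a coefficient. *)
Lemma clearable_D (a b : 'I_n) : (a < b)%N -> clearable (fun R Y Z D => D a b).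
Proof.
have [d] := ubnP (b - a); elim: d b => // d IHd b le_d lt_ab.
have [eq_b|ne_b] := eqVneq (a.+1) (b : nat).
  exists 0%N, ('X_a)%:MP => R Y Z D _; rewrite expr0 mul1r rim_eval_rim /rim.
  by rewrite eq_b valK.
have lt_c : (b.-1 < n)%N by have := ltn_ord b; lia.
pose c := Ordinal lt_c; have cE : c.+1 = b by rewrite /=; lia.
have [e [H HP]] : clearable (fun R Y Z D => D a c) by apply: IHd; rewrite /=; lia.
pose W : rim_poly := \prod_x 'X_x.
exists e.+1, (\prod_(x | x != c) 'X_x *
  ('X_a * (('X_c)%:MP * W ^+ e) + 'X_b * H)) => R Y Z D frm.
rewrite !(rim_evalM, rim_evalD, rim_evalX, rim_eval_var, rim_eval_rim, rim_eval_prod).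
rewrite -HP //; have -> : rim Y Z D c = D c b by rewrite /rim cE valK.
have lt_ac : (a < c)%N by rewrite /=; lia.
have lt_cb : (c < b)%N by rewrite /=; lia.
have := frame_plucker frm lt_ac lt_cb.
rewrite exprS {1}(bigD1 c) //=; move: (\prod_(x | _) Y x) (\prod_x Y x) => r w rel.
have -> : Y c * r * w ^+ e * D a b = r * (w ^+ e * (Y c * D a b)) by ring.
by rewrite -rel; ring.
Qed.

(** Y_1 Y_n Z_a = Y_a Y_1 Z_n, and Y_1 Z_n is the last rim element plus
    D_(1,n). *)
Lemma clearable_Z (a : 'I_n) : clearable (fun R Y Z D => Z a).
Proof.
have [e [H HP]] := clearable_D first_lt_last.
pose W : rim_poly := \prod_x 'X_x.
exists e.+1, (\prod_(x | (x != first_idx) && (x != last_idx)) 'X_x *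
  ('X_a * (('X_last_idx)%:MP * W ^+ e + H))) => R Y Z D frm.
rewrite !(rim_evalM, rim_evalD, rim_evalX, rim_eval_var, rim_eval_rim, rim_eval_prod).
rewrite -HP //.
have -> : rim Y Z D last_idx = Y first_idx * Z last_idx - D first_idx last_idx.
  by rewrite /rim insubN //= -leqNgt; lia.
have ne_lf : last_idx != first_idx by rewrite -val_eqE /=; lia.
rewrite exprS {1}(bigD1 first_idx) //= (bigD1 last_idx) //=.
move: (\prod_(x | _) Y x) (\prod_x Y x) => r w.
have -> : Y first_idx * (Y last_idx * r) * w ^+ e * Z a
    = r * w ^+ e * Y first_idx * (Y last_idx * Z a) by ring.
by rewrite (frame_prop frm last_idx a); ring.
Qed.

Lemma clearable_coord (k : 'I_N) : clearable (fun R Y Z D => coords Y Z D k).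
Proof.
have lt_k := fst_lt_snd k; rewrite /coords.
case: (splitP (fst_idx k)) => [a Ea|a _]; last first.
  by exists 0%N, 0 => R Y Z D _; rewrite rim_eval0 mulr0.
case: (splitP (snd_idx k)) => [b Eb|c _].
  by apply: clearable_D; rewrite -Ea -Eb.
case: (c == ord0); last exact: clearable_Z.
by exists 0%N, 'X_a => R Y Z D _; rewrite rim_eval_var mul1r.
Qed.

Lemma clearable_add f g : clearable f -> clearable g ->
  clearable (fun R Y Z D => f R Y Z D + g R Y Z D).
Proof.
move=> [e1 [H1 P1]] [e2 [H2 P2]]; pose W : rim_poly := \prod_x 'X_x.
exists (e1 + e2)%N, (W ^+ e2 * H1 + W ^+ e1 * H2) => R Y Z D frm.
rewrite !(rim_evalM, rim_evalD, rim_evalX, rim_eval_prod) -P1 // -P2 //.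
by rewrite exprD; ring.
Qed.

Lemma clearable_mul f g : clearable f -> clearable g ->
  clearable (fun R Y Z D => f R Y Z D * g R Y Z D).
Proof.
move=> [e1 [H1 P1]] [e2 [H2 P2]].
exists (e1 + e2)%N, (H1 * H2) => R Y Z D frm.
by rewrite rim_evalM -P1 // -P2 // exprD; ring.
Qed.

Lemma clearable_ext f g : (forall R Y Z D, f R Y Z D = g R Y Z D) ->
  clearable f -> clearable g.
Proof. by move=> fg [e [H HP]]; exists e, H => R Y Z D frm; rewrite -fg HP. Qed.

Lemma clearable_int c : clearable (fun R Y Z D => c%:~R).
Proof. by exists 0%N, c%:~R => R Y Z D _; rewrite rim_eval_int mul1r. Qed.

Lemma clearable_exp f e : clearable f -> clearable (fun R Y Z D => f R Y Z D ^+ e).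
Proof.
move=> cf; elim: e => [|e IHe].
  exact: (clearable_ext _ (clearable_int 1)).
by apply: (clearable_ext _ (clearable_mul cf IHe)) => R Y Z D; rewrite exprS.
Qed.

Lemma clearable_poly (Q : {mpoly int[N]}) :
  clearable (fun R Y Z D => int_eval (coords Y Z D) Q).
Proof.
elim/mpolyind: Q => [|c e Q _ _ IHQ].
  by apply: (clearable_ext _ (clearable_int 0)) => R Y Z D; rewrite [RHS]rmorph0.
have mono : clearable (fun R Y Z D => \prod_(k <- enum 'I_N) coords Y Z D k ^+ e k).
  elim: (enum _) => [|k s IHs].
    by apply: (clearable_ext _ (clearable_int 1)) => R Y Z D; rewrite big_nil.
  apply: (clearable_ext _ (clearable_mul (clearable_exp (e k) (clearable_coord k)) IHs)).
  by move=> R Y Z D; rewrite big_cons.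
apply: (clearable_ext _ (clearable_add (clearable_mul (clearable_int c) mono) IHQ)).
move=> R Y Z D; rewrite /int_eval mmapD mmapZ mmapX; congr (_ * _ + _).
by rewrite /mmap1 big_enum.
Qed.

(** A relation between the coordinates of a frame becomes, after clearing
    denominators, a polynomial relation between its Y a and its rim elements.  If
    these are independent, that relation is trivial, and then it holds in every
    other frame too. *)
Lemma rim_independent_kernel (R S : comNzRingType) Y Z D Y' Z' D' Q :
    @frame R Y Z D -> @frame S Y' Z' D' ->
    (forall H, rim_eval Y (rim Y Z D) H = 0 -> H = 0) ->
    GRing.lreg (\prod_a Y' a) ->
  int_eval (coords Y Z D) Q = 0 -> int_eval (coords Y' Z' D') Q = 0.
Proof.
move=> frm frm' indep reg Q0; have [e [H HP]] := clearable_poly Q.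
have H0 : H = 0 by apply: indep; rewrite -HP // Q0 mulr0.
apply: (@GRing.lregX _ _ e reg); rewrite mulr0.
by rewrite (HP S Y' Z' D' frm') H0 rim_eval0.
Qed.

Section Wedge.
Variables (R : comNzRingType) (u v : 'I_m -> R).

Definition wedge_Y a := u (idx a) * v (idx1 n).
Definition wedge_Z a := u (idx a) * v (idx2 n).
Definition wedge_D a b := u (idx a) * v (idx b) - u (idx b) * v (idx a).

Lemma wedge_frame : frame wedge_Y wedge_Z wedge_D.
Proof. by split=> [a b|a b c _ _]; rewrite /wedge_Y /wedge_Z /wedge_D; ring. Qed.

Lemma coords_wedge : u (idx1 n) = 0 -> u (idx2 n) = 0 ->
  coords wedge_Y wedge_Z wedge_D =1 wedge u v.
Proof.
move=> u1 u2 k; have lt_k := fst_lt_snd k; rewrite /coords /wedge.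
have uv0 (c : 'I_2) : u (rshift n c) = 0.
  by have [->|->] : c = ord0 \/ c = ord_max
    by case: c => [[|[|]]] // i; [left|right]; apply: val_inj.
case: (splitP (fst_idx k)) => a Ea; case: (splitP (snd_idx k)) => b Eb.
- have -> : fst_idx k = idx a by apply: val_inj.
  by have -> : snd_idx k = idx b by apply: val_inj.
- have -> : fst_idx k = idx a by apply: val_inj.
  have -> : snd_idx k = rshift n b by apply: val_inj.
  rewrite uv0 mul0r subr0 /wedge_Y /wedge_Z.
  have [->|->] : b = ord0 \/ b = ord_max
    by case: (b) => [[|[|]]] // i; [left|right]; apply: val_inj.
    by rewrite eqxx.
  by rewrite -val_eqE.
- by move: lt_k; rewrite Ea Eb ltnNge ltnW // ltn_addr.
have -> : fst_idx k = rshift n a by apply: val_inj.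
have -> : snd_idx k = rshift n b by apply: val_inj.
by rewrite !uv0 !mul0r subr0.
Qed.

End Wedge.

Lemma coords_eq (R : comNzRingType) Y Z D Y' Z' D' :
    Y =1 Y' -> Z =1 Z' -> (forall a b : 'I_n, (a < b)%N -> D a b = D' a b) ->
  @coords R Y Z D =1 coords Y' Z' D'.
Proof.
move=> eY eZ eD k; have lt_k := fst_lt_snd k; rewrite /coords.
case: (splitP (fst_idx k)) => a Ea; case: (splitP (snd_idx k)) => b Eb //.
  by rewrite eD // -Ea -Eb.
by rewrite eY eZ.
Qed.

(** Normalizing u = Y and the last two entries of v to 1 and Z_1 / Y_1 leaves only
    the freedom to add a multiple of u to v, which is used to make v_1 = 0; then
    v_a = D_(1,a) / Y_1. *)
Lemma frame_realized (F : fieldType) Y Z D : @frame F Y Z D ->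
    (forall a, Y a != 0) ->
  exists u v, [/\ u (idx1 n) = 0, u (idx2 n) = 0 & coords Y Z D =1 wedge u v].
Proof.
move=> frm nzY; pose o := first_idx.
pose u (i : 'I_m) : F := if split i is inl a then Y a else 0.
pose v (i : 'I_m) : F := match split i with
  | inl a => if a == o then 0 else D o a / Y o
  | inr c => if c == ord0 then 1 else Z o / Y o end.
have uE a : u (idx a) = Y a by rewrite /u (unsplitK (inl a)).
have u1 : u (idx1 n) = 0 by rewrite /u (unsplitK (inr ord0)).
have u2 : u (idx2 n) = 0 by rewrite /u (unsplitK (inr ord_max)).
have vE a : v (idx a) = if a == o then 0 else D o a / Y o.
  by rewrite /v (unsplitK (inl a)).
have v1 : v (idx1 n) = 1 by rewrite /v (unsplitK (inr ord0)).
have v2 : v (idx2 n) = Z o / Y o by rewrite /v (unsplitK (inr ord_max)).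
exists u, v; split=> // k; rewrite -coords_wedge //; apply: coords_eq => [a|a|a b lt_ab].
- by rewrite /wedge_Y uE v1 mulr1.
- by rewrite /wedge_Z uE v2 mulrA (frame_prop frm) mulrAC divff ?mul1r.
have o_le c : (o <= c)%N by [].
have nzb : b != o by rewrite -val_eqE /=; lia.
rewrite /wedge_D !uE !vE (negPf nzb); have [->|nza] := eqVneq a o.
  by rewrite mulr0 subr0 mulrC divfK.
have lt_oa : (o < a)%N by move: nza; rewrite -val_eqE /=; lia.
apply: (mulfI (nzY o)); have := frame_plucker frm lt_oa lt_ab => rel.
have nzo := nzY o.
transitivity (Y a * D o b - Y b * D o a); first by rewrite -rel addrK.
by field.
Qed.

End Coordinates.

(** * Mutating a seed with skew-symmetric matrix *)

Section SubfieldPredicate.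
Variables (F : fieldType) (S : F -> Prop).

Definition subfield_pred : {pred F} := fun y => `[< in_subfield S y >].

Fact subfield_pred_closed : divring_closed subfield_pred.
Proof.
split=> [|y z /asboolP Sy /asboolP Sz|y z /asboolP Sy /asboolP Sz]; apply/asboolP.
- exact: in_subfield_one.
- exact: in_subfield_sub.
- by apply: in_subfield_mul => //; exact: in_subfield_inv.
Qed.

HB.instance Definition _ :=
  GRing.isDivringClosed.Build F subfield_pred subfield_pred_closed.

Lemma in_subfieldP y : reflect (in_subfield S y) (y \in subfield_pred).
Proof. exact: asboolP. Qed.

Lemma mpolyOver_subfieldP n (Q : {mpoly F[n]}) :
  (forall e, in_subfield S Q@_e) <-> Q \is a mpolyOver n subfield_pred.
Proof.
by split=> [SQ|/mpolyOverP SQ e]; [apply/mpolyOverP => e|]; apply/in_subfieldP.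
Qed.

End SubfieldPredicate.

Lemma in_subfield_trans (F : fieldType) (S S' : F -> Prop) y :
  (forall z, S z -> in_subfield S' z) -> in_subfield S y -> in_subfield S' y.
Proof.
move=> sub; elim=> {y} [y /sub //||y z _ Sy _ Sz|y z _ Sy _ Sz|y _ Sy].
- exact: in_subfield_one.
- exact: in_subfield_sub.
- exact: in_subfield_mul.
- exact: in_subfield_inv.
Qed.

Section Exchange.
Variables (F : fieldType) (char0 : forall i, i.+1%:R != 0 :> F) (S : F -> Prop).
Variables (n : nat) (x : 'I_n -> F) (k : 'I_n) (r : {mpoly F[n]}).

Definition update (v : 'I_n -> F) (y : F) : 'I_n -> F :=
  fun i => if i == k then y else v i.

Hypothesis r_over : r \is a mpolyOver n (subfield_pred S).
Hypothesis r_indep : forall v y, r.@[update v y] = r.@[v].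
Hypothesis r_neq0 : r.@[x] != 0.

(** Multiplying a relation of degree less than d for the new cluster by x_k ^ d
    gives a relation H between the old variables, hence H = 0.  The exchange
    v_k -> r(v) / v_k is an involution on points, because r is independent of the
    k-th variable, so H = 0 forces the relation to vanish at every point where
    v_k and r(v) are nonzero. *)
Lemma exchange_independent : alg_independent (in_subfield S) x ->
  alg_independent (in_subfield S) (update x (r.@[x] / x k)).
Proof.
move=> indep Q /mpolyOver_subfieldP Q_over Q0; pose d := msize Q.
pose strip (e : 'X_{1..n}) : 'X_{1..n} := [multinom if i == k then 0%N else e i | i < n].
pose H := \sum_(e <- msupp Q)
  Q@_e *: (r ^+ e k * 'X_k ^+ (d - e k) * 'X_[strip e]).
have H_over : H \is a mpolyOver n (subfield_pred S).
  apply: rpred_sum => e _; apply: mpolyOverZ; first exact: (mpolyOverP _ Q_over).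
  by rewrite !rpredM // ?rpredX // mpolyOverX.
have HE v : v k != 0 -> H.@[v] = v k ^+ d * Q.@[update v (r.@[v] / v k)].
  move=> nz; rewrite [Q.@[_]]mevalE rmorph_sum mulr_sumr; apply: eq_big_seq => e Qe.
  rewrite /= mevalZ !mevalM !rmorphXn /= mevalXU mevalX [RHS]mulrCA; congr (_ * _).
  rewrite [in RHS](bigD1 k) //= [in LHS](bigD1 k) //= mnmE eqxx expr0 mul1r.
  rewrite /update eqxx mulrA; congr (_ * _).
    have le_d : (e k <= d)%N.
      by apply: leq_trans (ltnW (msize_mdeg_lt Qe)); rewrite mdegE (bigD1 k) //= leq_addr.
    by rewrite expr_div_n mulrCA -[in RHS](subnK le_d) exprD mulfK // expf_neq0.
  by apply: eq_bigr => i ne_ik; rewrite mnmE (negPf ne_ik).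
have nz_xk : x k != 0.
  apply: contraTneq isT => xk0; suff /eqP : 'X_k = 0 :> {mpoly F[n]}.
    by rewrite -msupp_eq0 msuppX.
  apply: indep; last by rewrite mevalXU.
  by apply/mpolyOver_subfieldP; rewrite mpolyOverX.
have H0 : H = 0.
  by apply: indep; [apply/mpolyOver_subfieldP|rewrite HE // Q0 mulr0].
have nz_r : r != 0 by apply: contraNneq r_neq0 => ->; rewrite meval0.
have nz_X : 'X_k != 0 :> {mpoly F[n]} by rewrite -msupp_eq0 msuppX.
suff /eqP : Q * ('X_k * r) = 0 by rewrite !mulf_eq0 (negPf nz_X) (negPf nz_r) !orbF => /eqP.
apply: (mpoly_vanish char0) => w; rewrite !mevalM mevalXU.
have [->|nz_w] := eqVneq (w k) 0; first by rewrite mul0r mulr0.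
have [->|nz_rw] := eqVneq r.@[w] 0; first by rewrite !mulr0.
pose v := update w (r.@[w] / w k).
have vk : v k = r.@[w] / w k by rewrite /v /update eqxx.
have nz_v : v k != 0 by rewrite vk mulf_neq0 // invr_eq0.
have := HE v nz_v; rewrite H0 meval0 => /esym/eqP.
rewrite mulf_eq0 expf_eq0 (negPf nz_v) andbF /= => /eqP Qv.
rewrite [Q.@[w]](_ : _ = 0) ?mul0r // -[RHS]Qv; apply: meval_eq => i.
rewrite /v r_indep -/v vk /update; case: eqP => [->|/eqP ne_ik].
  by rewrite invf_div mulrCA divff ?mulr1.
by rewrite /v /update (negPf ne_ik).
Qed.

End Exchange.

Section Ambient.
Variables (n : nat) (J : finType) (F : fieldType) (p : J -> F).
Hypothesis amb : ambient n p.
Local Notation E := (coef_field p).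
Local Notation S := (fun y => exists j, y = p j).

Lemma ambient_char0 i : i.+1%:R != 0 :> F.
Proof.
apply/eqP => i0; have /eqP : (i.+1%:R)%:MP = 0 :> {mpoly int[#|J|]}.
  by apply: (proj1 amb); rewrite map_mpolyC mevalC /= rmorph_nat.
by rewrite mpolyC_eq0 pnatr_eq0.
Qed.

Lemma ambient_p_neq0 j : p j != 0.
Proof.
apply/eqP => j0; have /eqP : 'X_(enum_rank j) = 0 :> {mpoly int[#|J|]}.
  by apply: (proj1 amb); rewrite map_mpolyX mevalXU enum_rankK.
by rewrite -msupp_eq0 msuppX.
Qed.

Lemma trop_val_neq0 c : trop_val p c != 0.
Proof. by apply/prodf_neq0 => j _; rewrite expfz_neq0 ?ambient_p_neq0. Qed.

Lemma trop_val0 : trop_val p 0 = 1.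
Proof. by rewrite /trop_val big1 // => j _; rewrite ffunE expr0z. Qed.

Lemma trop_valD c d : trop_val p (c + d) = trop_val p c * trop_val p d.
Proof.
rewrite /trop_val -big_split; apply: eq_bigr => j _.
by rewrite ffunE expfzDr ?ambient_p_neq0.
Qed.

Lemma trop_val_sum (I : Type) (s : seq I) (c : I -> trop J) :
  trop_val p (\sum_(i <- s) c i) = \prod_(i <- s) trop_val p (c i).
Proof.
elim: s => [|i s IHs]; first by rewrite !big_nil trop_val0.
by rewrite !big_cons trop_valD IHs.
Qed.

Lemma trop_val_gen j : trop_val p (trop_gen j) = p j.
Proof.
rewrite /trop_val (bigD1 j) //= ffunE eqxx expr1z big1 ?mulr1 // => i ne_ij.
by rewrite ffunE (negPf ne_ij) expr0z.
Qed.

Lemma trop_val_over c : trop_val p c \in subfield_pred S.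
Proof.
apply: rpred_prod => j _; case: (c j) => e; rewrite ?NegzE -?exprnN ?rpredV;
  by apply/rpredX/asboolP/in_subfield_gen; exists j.
Qed.

(** Multiplying by a large power of all generators turns both Laurent monomials
    into monomials; the sum of two monomials is nonzero, also when they are equal.
    This makes the right hand side of the exchange relation nonzero for a variable
    whose column in the matrix is 0. *)
Lemma trop_val_add_neq0 c d : trop_val p c + trop_val p d != 0.
Proof.
pose M := (\sum_j (`|c j| + `|d j|))%N; pose s : trop J := [ffun=> M%:Z].
have bnd (b : trop J) : (forall j, `|b j| <= M)%N -> exists e : 'X_{1..#|J|},
    trop_val p (b + s) = (map_mpoly intr 'X_[e]).@[fun i => p (enum_val i)].
  move=> leM; exists [multinom absz ((b + s)%R (enum_val i)) | i < #|J|].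
  rewrite map_mpolyX mevalX /trop_val (reindex_onto enum_val enum_rank) /=; last first.
    by move=> j _; rewrite enum_rankK.
  apply: eq_big => [i|i _]; first by rewrite enum_valK eqxx.
  rewrite mnmE !ffunE exprnP.
  by congr (_ ^ _); move: (b _) (leM (enum_val i)) => z le_z; rewrite gez0_abs; lia.
have le_cd j : (`|c j| + `|d j| <= M)%N by rewrite /M (bigD1 j) //= leq_addr.
have [e1 E1] : exists e : 'X_{1..#|J|},
    trop_val p (c + s) = (map_mpoly intr 'X_[e]).@[fun i => p (enum_val i)].
  by apply: bnd => j; apply: leq_trans (le_cd j); rewrite leq_addr.
have [e2 E2] : exists e : 'X_{1..#|J|},
    trop_val p (d + s) = (map_mpoly intr 'X_[e]).@[fun i => p (enum_val i)].
  by apply: bnd => j; apply: leq_trans (le_cd j); rewrite leq_addl.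
apply/eqP => cd0; have : 'X_[e1] + 'X_[e2] = 0 :> {mpoly int[#|J|]}.
  apply: (proj1 amb); rewrite rmorphD /= mevalD -E1 -E2 !trop_valD -mulrDl cd0.
  exact: mul0r.
move/(congr1 (mcoeff e1)); rewrite mcoeffD !mcoeffX eqxx mcoeff0.
by case: (e2 == e1).
Qed.

Section IndependentCluster.
Variable x : 'I_n -> F.
Hypothesis indep : alg_independent E x.

Lemma independent_neq0 i : x i != 0.
Proof.
apply/eqP => xi0; have /eqP : 'X_i = 0 :> {mpoly F[n]}.
  apply: indep; last by rewrite mevalXU.
  by apply/(mpolyOver_subfieldP S); rewrite mpolyOverX.
by rewrite -msupp_eq0 msuppX.
Qed.

End IndependentCluster.

Definition plus_exp (s : seed n p) (k : 'I_n) : 'X_{1..n} :=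
  [multinom if (0 < bmat s i k)%R then `|bmat s i k|%N else 0%N | i < n].
Definition minus_exp (s : seed n p) (k : 'I_n) : 'X_{1..n} :=
  [multinom if (bmat s i k < 0)%R then `|bmat s i k|%N else 0%N | i < n].

Lemma mon_plusE s k : mon_plus s k = \prod_i cvar s i ^+ plus_exp s k i.
Proof.
rewrite /mon_plus big_mkcond; apply: eq_bigr => i _; rewrite mnmE.
by case: ifP => // lt0; rewrite -{1}[bmat s i k]gtz0_abs.
Qed.

Lemma mon_minusE s k : mon_minus s k = \prod_i cvar s i ^+ minus_exp s k i.
Proof.
rewrite /mon_minus big_mkcond; apply: eq_bigr => i _; rewrite mnmE.
by case: ifP => // lt0; rewrite -ltz0_abs.
Qed.

Lemma bmat_diag (s : seed n p) k : bmat s k k = 0.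
Proof.
case: (seed_sign s k k) => [[]//|]; rewrite -expr2.
by have := sqr_ge0 (bmat s k k); lia.
Qed.

Definition exchange_poly (s : seed n p) (k : 'I_n) : {mpoly F[n]} :=
  trop_val p (pplus s k) *: 'X_[plus_exp s k]
    + trop_val p (pminus s k) *: 'X_[minus_exp s k].

Lemma exchange_poly_eval s k : (exchange_poly s k).@[cvar s]
  = trop_val p (pplus s k) * mon_plus s k + trop_val p (pminus s k) * mon_minus s k.
Proof. by rewrite mevalD !mevalZ !mevalX mon_plusE mon_minusE. Qed.

Lemma exchange_poly_over s k : exchange_poly s k \is a mpolyOver n (subfield_pred S).
Proof. by rewrite rpredD // mpolyOverZ ?trop_val_over ?mpolyOverX. Qed.

Lemma exchange_poly_indep s k v y :
  (exchange_poly s k).@[update k v y] = (exchange_poly s k).@[v].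
Proof.
rewrite !mevalD !mevalZ !mevalX; congr (_ * _ + _ * _); apply: eq_bigr => i _;
  by rewrite mnmE /update; case: eqP => // ->; rewrite bmat_diag ltxx !expr0.
Qed.

Lemma exchange_poly_neq0 s k : (exchange_poly s k).@[cvar s] != 0.
Proof.
have [indep _] := seed_basis s.
apply/eqP => /indep; have over := exchange_poly_over s k.
move=> /(_ ((mpolyOver_subfieldP S _).2 over)); rewrite /exchange_poly.
have [<-|ne] := eqVneq (plus_exp s k) (minus_exp s k).
  move/(congr1 (mcoeff (plus_exp s k))); rewrite mcoeff0 mcoeffD !mcoeffZ mcoeffX eqxx !mulr1.
  by apply/eqP/trop_val_add_neq0.
move/(congr1 (mcoeff (plus_exp s k))).
rewrite mcoeff0 mcoeffD !mcoeffZ !mcoeffX eqxx [minus_exp _ _ == _]eq_sym (negPf ne).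
by rewrite mulr1 mulr0 addr0; apply/eqP/trop_val_neq0.
Qed.

Definition mutated_var (s : seed n p) k : 'I_n -> F :=
  update k (cvar s) ((exchange_poly s k).@[cvar s] / cvar s k).

(** The field generated by the new cluster contains the old one, as
    x_k = r(x') / x'_k with the same exchange polynomial r. *)
Lemma mutated_basis s k : transcendence_basis p (mutated_var s k).
Proof.
have [indep gen] := seed_basis s; split.
  apply: exchange_independent => //; first exact: ambient_char0.
  - exact: exchange_poly_over.
  - exact: exchange_poly_indep.
  - exact: exchange_poly_neq0.
move=> y; have [q [nz_q q_over qy]] := gen y; exists q; split=> // i.
apply: in_subfield_trans (q_over i) => z [[j ->]|[l ->]].
  by apply: in_subfield_gen; left; exists j.
set S' := (fun z => _) in gen *; pose x' := mutated_var s k.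
have x'_in l' : x' l' \in subfield_pred S'.
  by apply/asboolP/in_subfield_gen; right; exists l'.
have [->|ne_lk] := eqVneq l k; last first.
  by have := x'_in l; rewrite {1}/x' /mutated_var /update (negPf ne_lk) => /asboolP.
have nz := independent_neq0 indep.
have x'k : cvar s k = (exchange_poly s k).@[x'] / x' k.
  rewrite /x' /mutated_var exchange_poly_indep /update eqxx.
  by rewrite invf_div mulrC divfK ?exchange_poly_neq0.
apply/(@in_subfieldP F S'); rewrite x'k rpredM ?rpredV //.
rewrite mevalE; apply: rpred_sum => e _; apply: rpredM; last first.
  by apply: rpred_prod => l' _; apply: rpredX.
apply/asboolP; apply: in_subfield_trans ((mpolyOver_subfieldP S _).2 (exchange_poly_over s k) e).
by move=> t [j ->]; apply: in_subfield_gen; left; exists j.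
Qed.

Definition skew (B : 'M[int]_n) : Prop := forall i j, B i j = - B j i.

Definition half_term (a b : int) : int := ((`|a| * b + a * `|b|) %/ 2)%Z.

Lemma half_termE a b : half_term a b =
  if 0 <= a then if 0 <= b then a * b else 0 else if 0 <= b then 0 else - (a * b).
Proof.
rewrite /half_term; case: (ger0P a) => a0; case: (ger0P b) => b0.
- by rewrite (_ : _ + _ = a * b * 2) ?mulzK //; ring.
- by rewrite mulrN subrr div0z.
- by rewrite mulNr addNr div0z.
by rewrite (_ : _ + _ = - (a * b) * 2) ?mulzK //; ring.
Qed.

(** The correction term of matrix mutation is antisymmetric under transposition,
    which is why mutation preserves skew-symmetry.  In the quotient by 2 the
    dividend is always even. *)
Lemma half_termNN a b : half_term (- b) (- a) = - half_term a b.
Proof.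
rewrite !half_termE !oppr_ge0; case: (ltgtP a 0) => [a0|a0|->]; case: (ltgtP b 0) => [b0|b0|->];
  by rewrite ?mulr0 ?mul0r ?oppr0 ?lexx // ?mulrNN ?opprK 1?mulrC.
Qed.

Lemma mutation_bmatE k (s t : seed n p) i j : mutation k s t -> bmat t i j =
  if (i == k) || (j == k) then - bmat s i j
  else bmat s i j + half_term (bmat s i k) (bmat s k j).
Proof. by move/mut_bmat => ->. Qed.

Lemma mutation_skew k (s t : seed n p) :
  mutation k s t -> skew (bmat s) <-> skew (bmat t).
Proof.
move=> mu; split=> sk i j; have Eij := mutation_bmatE i j mu;
  have Eji := mutation_bmatE j i mu.
  rewrite {}Eij {}Eji orbC; case: ifP => _; first by rewrite sk.
  by rewrite (sk i k) (sk k j) half_termNN (sk i j) opprD.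
have Eik := mutation_bmatE i k mu; have Eki := mutation_bmatE k i mu.
have Ejk := mutation_bmatE j k mu; have Ekj := mutation_bmatE k j mu.
rewrite eqxx orbT in Eik; rewrite eqxx orbT in Ejk; rewrite eqxx /= in Eki Ekj.
have := sk i j; rewrite {}Eij {}Eji orbC; case: ifP => _.
  by move/oppr_inj.
have := sk i k; have := sk k j; rewrite Eik Eki Ekj Ejk => /oppr_inj Ekj' /oppr_inj Eik'.
by rewrite Eik' Ekj' half_termNN opprD => /addIr.
Qed.

Lemma mutation_equivalent_skew (s0 s : seed n p) :
  mutation_equivalent s0 s -> skew (bmat s0) <-> skew (bmat s).
Proof. by elim=> [|k s1 t _ IHs mu]; [|apply: (iff_trans IHs (mutation_skew mu))]. Qed.

Lemma cartan_D_sym i j : cartan_D n i j = cartan_D n j i.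
Proof. by rewrite !mxE eq_sym orbC. Qed.

(** The Cartan matrix of type D_n is symmetric, so a matrix with this Cartan
    counterpart is skew-symmetric by the sign condition; skew-symmetry then travels
    along mutations in both directions. *)
Lemma type_D_skew (s0 s : seed n p) : type_D s0 -> mutation_equivalent s0 s ->
  skew (bmat s).
Proof.
move=> [t [w [eq_t cartan]]] eq_s; apply/(mutation_equivalent_skew eq_s).
apply/(mutation_equivalent_skew eq_t) => i j.
have [->|ne_ij] := eqVneq i j; first by rewrite bmat_diag oppr0.
have abs_eq : `|bmat t i j| = `|bmat t j i|.
  have := cartan ((w^-1)%g i) ((w^-1)%g j); have := cartan ((w^-1)%g j) ((w^-1)%g i).
  rewrite cartan_D_sym => <-; rewrite !mxE !permKV (negPf ne_ij) eq_sym (negPf ne_ij).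
  by move/oppr_inj.
case: (seed_sign t i j) => [[-> ->]|]; first by rewrite oppr0.
by move: abs_eq; case: (ltgtP (bmat t i j) 0) => [a|a|->]; case: (ltgtP (bmat t j i) 0) => [b|b|->]; nia.
Qed.

(** The new coefficients are the positive and negative parts of the prescribed
    quotients.  Skew-symmetry is what guarantees the sign condition for the new
    matrix: mutation can destroy that condition in general. *)
Lemma mutation_exists (s : seed n p) k : skew (bmat s) -> exists t, mutation k s t.
Proof.
move=> sk.
pose ratio i : trop J := if i == k then pminus s k - pplus s k else
  if 0 <= bmat s k i then pplus s k *~ bmat s k i + (pplus s i - pminus s i)
  else pminus s k *~ bmat s k i + (pplus s i - pminus s i).
pose pp i : trop J := [ffun j => Num.max (ratio i j) 0].
pose pm i : trop J := [ffun j => Num.max (- ratio i j) 0].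
have ratioE i : pp i - pm i = ratio i.
  apply/ffunP => j; rewrite !ffunE /Order.max; move: (ratio i j) => z.
  by case: ifP => H1; case: ifP => H2; lia.
pose B := \matrix_(i, j) if (i == k) || (j == k) then - bmat s i j
  else bmat s i j + half_term (bmat s i k) (bmat s k j).
have norm i : trop_oplus (pp i) (pm i) = 0.
  apply/ffunP => j; rewrite !ffunE; move: (ratio i j) => z.
  case: (leP 0 z) => z0; first by rewrite [Num.max (- z) 0]max_r ?oppr_le0 // min_r.
  by rewrite max_l ?oppr_ge0 ?ltW // min_l // oppr_ge0 ltW.
have skB : skew B.
  move=> i j; rewrite !mxE orbC; case: ifP => _; first by rewrite sk.
  by rewrite (sk i k) (sk k j) half_termNN (sk i j) opprD.
have sgB i j : (B i j = 0 /\ B j i = 0) \/ B i j * B j i < 0.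
  rewrite (skB i j); move: (B j i) => b.
  by case: (ltgtP b 0) => [b_lt|b_gt|->]; [right|right|left]; nia.
exists (Seed (mutated_basis s k) norm sgB); split=> /=.
- by move=> i ne; rewrite /mutated_var /update (negPf ne).
- rewrite /mutated_var /update eqxx mulrC divfK ?exchange_poly_eval //.
  exact: (independent_neq0 (proj1 (seed_basis s))).
- by rewrite ratioE /ratio eqxx.
- by move=> i ne ge; rewrite ratioE /ratio (negPf ne) ge.
- move=> i ne le; rewrite ratioE /ratio (negPf ne); case: ifP => // ge.
  have -> : bmat s k i = 0 by lia.
  by rewrite !mulr0z.
by move=> i j; rewrite mxE.
Qed.

End Ambient.

(** * Geometry of the polygon *)

Section PolygonGeometry.
Variables (n : nat) (n_ge3 : (3 <= n)%N).
Local Notation V := (vertex n).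
Local Notation orbit := (@Defs.orbit n).
Local Notation vx i := (@lshift n n i : V).
Local Notation vb i := (@rshift n n i : V).

Lemma antipode_vx i : antipode (vx i) = vb i.
Proof. by rewrite /antipode (unsplitK (inl i)). Qed.

Lemma antipode_vb i : antipode (vb i) = vx i.
Proof. by rewrite /antipode (unsplitK (inr i)). Qed.

Lemma vertexP (a : V) : (exists i, a = vx i) \/ (exists i, a = vb i).
Proof.
case: (splitP a) => i Ei; [left|right]; exists i; exact: val_inj.
Qed.

Lemma antipodeK : involutive (@antipode n).
Proof.
by move=> a; case: (vertexP a) => [[i ->]|[i ->]];
  rewrite ?antipode_vx ?antipode_vb ?antipode_vx.
Qed.

Lemma antipode_val (a : V) :
  (antipode a : nat) = if (a < n)%N then (a + n)%N else (a - n)%N.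
Proof.
case: (vertexP a) => [[i ->]|[i ->]]; rewrite ?antipode_vx ?antipode_vb /=;
  case: ifP; have := ltn_ord i; lia.
Qed.

Lemma ccw_distE (a b : V) :
  ccw_dist a b = if (a <= b)%N then (b - a)%N else (b + (n + n) - a)%N.
Proof.
rewrite /ccw_dist; have := ltn_ord a; have := ltn_ord b; case: (leqP a b) => le_ab ltb lta.
  by rewrite -addnBAC // modnDr modn_small; lia.
by rewrite modn_small; lia.
Qed.

Lemma orbitC (a b : V) : orbit a b = orbit b a.
Proof. by rewrite /orbit (setUC [set a]) (setUC [set antipode a]). Qed.

Lemma orbit_antipode (a b : V) : orbit (antipode a) (antipode b) = orbit a b.
Proof. by rewrite /orbit !antipodeK setUC. Qed.

Lemma set2_inj (T : finType) (a b c d : T) : [set a; b] = [set c; d] ->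
  (a = c /\ b = d) \/ (a = d /\ b = c).
Proof.
move=> eq_s; have: a \in [set c; d] by rewrite -eq_s set21.
have: b \in [set c; d] by rewrite -eq_s set22.
have: c \in [set a; b] by rewrite eq_s set21.
have: d \in [set a; b] by rewrite eq_s set22.
rewrite !inE.
by do 4![case/orP=> /eqP ?]; subst; auto.
Qed.

Lemma orbit_inj (a b c d : V) : orbit a b = orbit c d ->
  [\/ a = c /\ b = d, a = d /\ b = c,
      a = antipode c /\ b = antipode d | a = antipode d /\ b = antipode c].
Proof.
move=> eq_o; have : [set a; b] \in orbit c d by rewrite -eq_o set21.
rewrite !inE => /orP[] /eqP/set2_inj[] E.
- exact: Or41. - exact: Or42. - exact: Or43. - exact: Or44.
Qed.

Lemma side_sym (a b : V) : side a b = side b a.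
Proof. by rewrite /side orbC. Qed.

Lemma side_antipode (a b : V) : side (antipode a) (antipode b) = side a b.
Proof.
rewrite /side !ccw_distE !antipode_val; have := ltn_ord a; have := ltn_ord b.
by case: (ltnP a n) => lta; case: (ltnP b n) => ltb; do !case: ifP; lia.
Qed.

Lemma side_orbit_eq (a b c d : V) : orbit a b = orbit c d -> side a b = side c d.
Proof.
by move/orbit_inj=> [] [-> ->]; rewrite ?side_antipode // side_sym ?side_antipode.
Qed.

Lemma is_side_orbitE (a b : V) : is_side_orbit (orbit a b) = side a b.
Proof.
apply/existsP/idP => [[c /existsP[d /andP[sd /eqP/side_orbit_eq ->]]]//|sd].
by exists a; apply/existsP; exists b; rewrite sd eqxx.
Qed.

Lemma diameter_not_side (a : V) : side a (antipode a) = false.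
Proof.
rewrite /side !ccw_distE !antipode_val; have := ltn_ord a.
by case: (ltnP a n) => lta; do !case: ifP; lia.
Qed.

Lemma label_not_side (s : symbol n) : is_label s -> ~~ is_side_orbit s.1.
Proof.
case/orP=> [/existsP[a /existsP[b /andP[/andP[_ dg] /eqP ->]]]|/existsP[a /eqP ->]] /=.
  by rewrite is_side_orbitE.
by rewrite is_side_orbitE diameter_not_side.
Qed.

Lemma is_label_plain (a b : V) : diagonal a b -> is_label (plain a b).
Proof.
move=> dg; apply/orP; left; apply/existsP; exists a; apply/existsP; exists b.
by rewrite dg eqxx.
Qed.

Lemma is_label_tilde (a : V) : is_label (tilde a).
Proof. by apply/orP; right; apply/existsP; exists a; rewrite eqxx. Qed.

Lemma antipode_neq (a : V) : a != antipode a.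
Proof.
rewrite -val_eqE /= antipode_val; have := ltn_ord a; case: ifP; lia.
Qed.

Lemma diagonal_diameter (a : V) : diagonal a (antipode a).
Proof. by rewrite /diagonal antipode_neq diameter_not_side. Qed.

Lemma plainC (a b : V) : plain a b = plain b a.
Proof. by rewrite /plain orbitC. Qed.

Lemma plain_antipode (a b : V) : plain (antipode a) (antipode b) = plain a b.
Proof. by rewrite /plain orbit_antipode. Qed.

Lemma tilde_antipode (a : V) : tilde (antipode a) = tilde a.
Proof. by rewrite /tilde orbit_antipode. Qed.

(** Up to the rotation by 180 degrees, a chord starts among the vertices 1, ..., n;
    the chord from i to the antipode of j is rotated to the one from j to the
    antipode of i, so one may take i < j. *)
Lemma plain_cases (a b : V) : a != b ->
  [\/ exists i, plain a b = plain (vx i) (vb i),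
      exists i j : 'I_n, (i < j)%N /\ plain a b = plain (vx i) (vx j)
    | exists i j : 'I_n, (i < j)%N /\ plain a b = plain (vx i) (vb j)].
Proof.
have vxx i j : plain (vb i) (vb j) = plain (vx i) (vx j).
  by rewrite -!antipode_vx plain_antipode.
have vxb i j : plain (vb i) (vx j) = plain (vx i) (vb j).
  by rewrite -antipode_vx -[vx j]antipode_vb plain_antipode.
have vxC i j : plain (vx i) (vb j) = plain (vx j) (vb i) by rewrite -vxb plainC.
have mixed i j : [\/ exists k, plain (vx i) (vb j) = plain (vx k) (vb k),
      exists k l : 'I_n, (k < l)%N /\ plain (vx i) (vb j) = plain (vx k) (vx l)
    | exists k l : 'I_n, (k < l)%N /\ plain (vx i) (vb j) = plain (vx k) (vb l)].
  case: (ltngtP i j) => [lt_ij|lt_ji|/val_inj ->].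
  - by apply: Or33; exists i, j.
  - by apply: Or33; exists j, i.
  by apply: Or31; exists j.
have same i j : vx i != vx j ->
    exists k l : 'I_n, (k < l)%N /\ plain (vx i) (vx j) = plain (vx k) (vx l).
  rewrite (inj_eq (@lshift_inj _ _)) => ne.
  case: (ltngtP i j) => [lt_ij|lt_ji|/val_inj E]; last by rewrite E eqxx in ne.
  - by exists i, j.
  - by exists j, i; rewrite plainC.
case: (vertexP a) => [[i ->]|[i ->]]; case: (vertexP b) => [[j ->]|[j ->]] ne.
- by apply: Or32; apply: same.
- exact: mixed.
- by rewrite vxb; exact: mixed.
rewrite vxx; apply: Or32; apply: same; apply: contraNneq ne => /lshift_inj ->.
exact: eqxx.
Qed.

Lemma tilde_cases (a : V) : exists i, tilde a = tilde (vx i).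
Proof.
case: (vertexP a) => [[i ->]|[i ->]]; exists i => //.
by rewrite -antipode_vx tilde_antipode.
Qed.

Lemma plain_diameter_cases (a : V) : exists i, plain a (antipode a) = plain (vx i) (vb i).
Proof.
case: (vertexP a) => [[i ->]|[i ->]]; exists i; rewrite ?antipode_vx // antipode_vb plainC //.
Qed.

Lemma ccw3 (a b c : V) : ccw [:: a; b; c] = (0 < ccw_dist a b < ccw_dist a c)%N.
Proof.
rewrite /ccw /= andbT; have -> // : ccw_dist a a = 0%N.
by rewrite ccw_distE leqnn subnn.
Qed.

Lemma ccw4 (a b c d : V) : ccw [:: a; b; c; d] =
  (0 < ccw_dist a b < ccw_dist a c)%N && (ccw_dist a c < ccw_dist a d)%N.
Proof.
rewrite /ccw /= andbT andbA; have -> // : ccw_dist a a = 0%N.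
by rewrite ccw_distE leqnn subnn.
Qed.

Lemma plain_vx_neq (i j : 'I_n) : i != j -> orbit (vx i) (vb i) != orbit (vx j) (vb j).
Proof.
apply: contraNneq => /orbit_inj; rewrite antipode_vx antipode_vb.
have ne_lr (k l : 'I_n) : vx k <> vb l by move/eqP; rewrite eq_lrshift.
by case=> [] [E _]; first [by apply/eqP/(@lshift_inj n n) | case: (ne_lr _ _ E)].
Qed.

Definition plain_diameter (i : 'I_n) : label n :=
  Sub (plain (vx i) (antipode (vx i))) (is_label_plain (diagonal_diameter (vx i))).

Lemma val_plain_diameter i : val (plain_diameter i) = plain (vx i) (vb i).
Proof. by rewrite /= antipode_vx. Qed.

Lemma plain_diameter_inj : injective plain_diameter.
Proof.
move=> i j /(congr1 val); rewrite !val_plain_diameter => -[E].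
by apply/eqP; apply: contraTT (erefl true) => /plain_vx_neq; rewrite E eqxx.
Qed.

Definition plain_diameters : {set label n} := [set plain_diameter i | i : 'I_n].

Lemma is_diameter_plain (a : V) : is_diameter (plain a (antipode a)).
Proof. by apply/existsP; exists a. Qed.

Lemma plain_diameters_noncrossing : noncrossing plain_diameters.
Proof.
apply/forallP => l; apply/implyP => /imsetP[i _ ->].
apply/forallP => l'; apply/implyP => /imsetP[j _ ->].
by rewrite /crossing !is_diameter_plain.
Qed.

(** A diagonal that is not a diameter cuts off on one side an arc of length at
    least 2 and less than n; the diameter through the first vertex inside this arc
    ends outside of it. *)
Lemma plain_crosses_diameter (a b : V) : diagonal a b -> b != antipode a ->
  exists i, crossing (plain a b) (val (plain_diameter i)).
Proof.
move=> dg ne; have not_diam : is_diameter (plain a b) = false.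
  apply/negbTE/negP => /existsP[c /eqP/orbit_inj E]; case/eqP: ne.
  by case: E => [] [-> ->]; rewrite ?antipodeK.
have [e cross] : exists e, chords_cross [set a; b] [set e; antipode e].
  have lt_s (c : V) : ((c + 1) %% (n + n) < n + n)%N by rewrite ltn_pmod; lia.
  pose succ c : V := Ordinal (lt_s c).
  have succ_val c : (succ c : nat) = if (c + 1 == n + n)%N then 0%N else (c + 1)%N.
    rewrite /=; case: eqP => [->|ne_c]; first exact: modnn.
    by rewrite modn_small //; have := ltn_ord c; lia.
  move: dg ne; rewrite /diagonal -!val_eqE /= /side !ccw_distE antipode_val => dg ne.
  have Ea := succ_val a; have Eb := succ_val b.
  have lta := ltn_ord a; have ltb := ltn_ord b.
  have [lt|ge] := ltnP (ccw_dist a b) n; [exists (succ a)|exists (succ b)].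
    rewrite /chords_cross; apply/existsP; exists a; apply/existsP; exists b.
    apply/existsP; exists (succ a).
    apply/existsP; exists (antipode (succ a)); rewrite !eqxx ccw4 /=.
    move: lt; rewrite !ccw_distE antipode_val Ea; move: dg ne.
    by do !case: ifP; lia.
  rewrite /chords_cross; apply/existsP; exists b; apply/existsP; exists a.
  apply/existsP; exists (succ b).
  apply/existsP; exists (antipode (succ b)); rewrite setUC !eqxx ccw4 /=.
  move: ge; rewrite !ccw_distE antipode_val Eb; move: dg ne.
  by do !case: ifP; lia.
have [i Ei] := plain_diameter_cases e; exists i.
rewrite /crossing not_diam val_plain_diameter -Ei /=.
apply/existsP; exists [set a; b]; rewrite set21 /=.
by apply/existsP; exists [set e; antipode e]; rewrite set21.
Qed.

Lemma tilde_crosses_diameter (a : V) :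
  exists i, crossing (tilde a) (val (plain_diameter i)).
Proof.
have [j Ej] := tilde_cases a; have [i ne] : exists i : 'I_n, j != i.
  have lt0 : (0 < n)%N by lia. have lt1 : (1 < n)%N by lia.
  have [E|ne] := eqVneq j (Ordinal lt0); last by exists (Ordinal lt0).
  by exists (Ordinal lt1); rewrite E.
exists i; rewrite Ej /crossing is_diameter_plain.
have -> : is_diameter (tilde (vx j)) by apply/existsP; exists (vx j).
by rewrite /= !antipode_vx plain_vx_neq.
Qed.

(** Every other label crosses a diameter of the first colour, so these n diameters
    form a cluster. *)
Lemma plain_diameters_maximal : maxset (@noncrossing n) plain_diameters.
Proof.
apply/maxsetP; split; first exact: plain_diameters_noncrossing.
move=> L /forallP nc inL; apply/eqP; rewrite eqEsubset inL andbT.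
apply/subsetP => l Ll; have no_cross i : ~~ crossing (val l) (val (plain_diameter i)).
  have /implyP/(_ Ll)/forallP/(_ (plain_diameter i))/implyP := nc l; apply.
  by apply: (subsetP inL); apply: imset_f.
case/orP: (valP l) => [/existsP[a /existsP[b /andP[dg /eqP El]]]|/existsP[a /eqP El]].
  have [Eb|ne] := eqVneq b (antipode a).
    have [i Ei] := plain_diameter_cases a; apply/imsetP; exists i => //.
    by apply: val_inj; rewrite val_plain_diameter El Eb.
  have [i cross] := plain_crosses_diameter dg ne.
  by rewrite -El (negPf (no_cross i)) in cross.
have [i cross] := tilde_crosses_diameter a.
by rewrite -El (negPf (no_cross i)) in cross.
Qed.

Lemma ccw_vx2 (i j : 'I_n) : (i < j)%N -> ccw [:: vx i; vx j; antipode (vx i)].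
Proof.
move=> lt_ij; rewrite ccw3 antipode_vx !ccw_distE /=.
by have := ltn_ord i; have := ltn_ord j; do !case: ifP; lia.
Qed.

Lemma ccw_vx2' (i j : 'I_n) : (i < j)%N -> ccw [:: vx j; vb i; antipode (vx j)].
Proof.
move=> lt_ij; rewrite ccw3 antipode_vx !ccw_distE /=.
by have := ltn_ord i; have := ltn_ord j; do !case: ifP; lia.
Qed.

Lemma ccw_vx3 (i j k : 'I_n) : (i < j)%N -> (j < k)%N ->
  ccw [:: vx i; vx j; vx k; antipode (vx i)].
Proof.
move=> lt_ij lt_jk; rewrite ccw4 antipode_vx !ccw_distE /=.
by have := ltn_ord k; do !case: ifP; lia.
Qed.

Lemma diagonal_vx_vb (i j k : 'I_n) : (i < j)%N -> (j < k)%N -> diagonal (vx j) (vb k).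
Proof.
move=> lt_ij lt_jk; rewrite /diagonal eq_lrshift /side !ccw_distE /=.
by have := ltn_ord k; do !case: ifP; lia.
Qed.

End PolygonGeometry.

(** * Evaluation of integer polynomials *)

Lemma meval_map_mpoly (R S : comNzRingType) (f : {rmorphism R -> S}) n
    (h : 'I_n -> S) (Q : {mpoly R[n]}) : (map_mpoly f Q).@[h] = mmap f h Q.
Proof.
elim/mpolyind: Q => [|c e Q _ _ IHQ]; first by rewrite !rmorph0.
rewrite rmorphD mevalD IHQ mmapD mmapZ mmapX; congr (_ + _).
by rewrite /= map_mpolyZ map_mpolyX mevalZ mevalX.
Qed.

Section Rename.
Variables (K : idomainType) (char0 : forall i, i.+1%:R != 0 :> K).
Variables (m n : nat) (e : 'I_n -> 'I_m).

Definition rename (Q : {mpoly K[n]}) : {mpoly K[m]} :=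
  mmap (@mpolyC m K) (fun i => 'X_(e i)) Q.

Lemma rename_map_eval (R : comNzRingType) (f : {rmorphism K -> R}) (w : 'I_m -> R) Q :
  mmap f w (rename Q) = mmap f (w \o e) Q.
Proof.
rewrite /rename; elim/mpolyind: Q => [|c d Q _ _ IHQ]; first by rewrite !mmap0.
rewrite !mmapD IHQ !mmapZ !mmapX rmorphM /= mmapC /mmap1 rmorph_prod.
congr (_ * _ + _); apply: eq_bigr => i _.
by rewrite rmorphXn /= mmapX mmap1U.
Qed.

Lemma rename_eq0 Q : injective e -> rename Q = 0 -> Q = 0.
Proof.
move=> e_inj Q0; apply: (mpoly_vanish char0) => v.
pose w j := if [pick i | e i == j] is Some i then v i else 0.
have wE : w \o e =1 v.
  move=> i; rewrite /w /=; case: pickP => [j /eqP/e_inj -> //|/(_ i)].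
  by rewrite eqxx.
have := rename_map_eval idfun w Q; rewrite Q0 mmap0 => /esym <-.
by apply: meval_eq => i; rewrite wE.
Qed.

Lemma rename_over (A : subringClosed K) Q : Q \is a mpolyOver n A ->
  rename Q \is a mpolyOver m A.
Proof.
move=> /mpolyOverP QA; apply: rpred_sum => d _; rewrite mul_mpolyC.
apply: mpolyOverZ; first exact: QA.
by apply: rpred_prod => i _; apply/rpredX/mpolyOverX.
Qed.

End Rename.

Section IntEval.
Variable n : nat.
Local Notation N := #|plucker_index (n + 2)|.

Lemma int_evalX (R : comNzRingType) (h : 'I_N -> R) k : int_eval h 'X_k = h k.
Proof. by rewrite /int_eval mmapX mmap1U. Qed.

Lemma int_rmorph_ext m (R : comNzRingType) (f g : {rmorphism {mpoly int[m]} -> R}) :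
  (forall k, f 'X_k = g 'X_k) -> f =1 g.
Proof.
move=> fg Q; elim/mpolyind: Q => [|c e Q _ _ IHQ]; first by rewrite !rmorph0.
rewrite !rmorphD IHQ -mul_mpolyC !rmorphM; congr (_ * _ + _).
  by rewrite -[c]intz !rmorph_int.
rewrite mpolyXE_id !rmorph_prod; apply: eq_bigr => k _.
by rewrite !rmorphXn fg.
Qed.

Lemma int_eval_eq (R : comNzRingType) (h h' : 'I_N -> R) Q :
  h =1 h' -> int_eval h Q = int_eval h' Q.
Proof.
move=> hh'; apply: (@int_rmorph_ext _ _ (mmap intr h) (mmap intr h')) => k.
by have := hh' k; rewrite -!int_evalX.
Qed.

Lemma rmorph_int_eval (R S : comNzRingType) (f : {rmorphism R -> S}) (h : 'I_N -> R) Q :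
  f (int_eval h Q) = int_eval (f \o h) Q.
Proof.
apply: (@int_rmorph_ext _ _ (f \o mmap intr h) (mmap intr (f \o h))) => k.
transitivity (f (int_eval h 'X_k)); first by [].
by rewrite int_evalX -[RHS]/(int_eval (f \o h) 'X_k) int_evalX.
Qed.

End IntEval.

Lemma intr_eq0_char0 (R : nzRingType) (char0 : forall i, i.+1%:R != 0 :> R) (c : int) :
  c%:~R = 0 :> R -> c = 0.
Proof.
case: c => [[|i]|i] //; first by move/eqP; rewrite (negPf (char0 i)).
by rewrite NegzE => /eqP; rewrite rmorphN oppr_eq0 (negPf (char0 i)).
Qed.

(** * The two kernels *)

Section CoordinateValues.
Variable n : nat.
Local Notation m := (n + 2)%N.
Local Notation N := #|plucker_index m|.

Lemma coords_D (R : comNzRingType) Y Z D (a b : 'I_n) (lt : (idx a < idx b)%N) :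
  @coords n R Y Z D (pair_idx lt) = D a b.
Proof.
by rewrite /coords fst_pair_idx snd_pair_idx (unsplitK (inl a)) (unsplitK (inl b)).
Qed.

Lemma coords_Y (R : comNzRingType) Y Z D (a : 'I_n) (lt : (idx a < idx1 n)%N) :
  @coords n R Y Z D (pair_idx lt) = Y a.
Proof.
by rewrite /coords fst_pair_idx snd_pair_idx (unsplitK (inl a)) (unsplitK (inr ord0)).
Qed.

Lemma coords_Z (R : comNzRingType) Y Z D (a : 'I_n) (lt : (idx a < idx2 n)%N) :
  @coords n R Y Z D (pair_idx lt) = Z a.
Proof.
by rewrite /coords fst_pair_idx snd_pair_idx (unsplitK (inl a)) (unsplitK (inr ord_max)).
Qed.

Lemma idx_lt_idx1 (a : 'I_n) : (idx a < idx1 n)%N.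
Proof. by rewrite /= addn0. Qed.

Lemma idx_lt_idx2 (a : 'I_n) : (idx a < idx2 n)%N.
Proof. by rewrite /= ltn_addr. Qed.

Lemma coords_ind (P : 'I_N -> Prop) :
    (forall a b (lt : (idx a < idx b)%N), P (pair_idx lt)) ->
    (forall a, P (pair_idx (idx_lt_idx1 a))) ->
    (forall a, P (pair_idx (idx_lt_idx2 a))) ->
    P (cut_idx n) ->
  forall k, P k.
Proof.
move=> PD PY PZ Pcut k; have lt_k := fst_lt_snd k.
have idxP (i : 'I_m) : [\/ exists a, i = idx a, i = idx1 n | i = idx2 n].
  case: (splitP i) => [a Ea|c Ec]; first by apply: Or31; exists a; apply: val_inj.
  case: c Ec => [[|[|//]] lt_c] Ec; first by apply: Or32; apply: val_inj.
  by apply: Or33; apply: val_inj.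
have cases (i j : 'I_m) (lt : (fst_idx k < snd_idx k)%N) (lt' : (i < j)%N) :
    fst_idx k = i -> snd_idx k = j -> k = pair_idx lt'.
  by move=> Ei Ej; apply: pair_idx_inj; rewrite ?fst_pair_idx ?snd_pair_idx.
have [[a Ea]|Ea|Ea] := idxP (fst_idx k); have [[b Eb]|Eb|Eb] := idxP (snd_idx k).
- have lt : (idx a < idx b)%N by rewrite -Ea -Eb.
  by rewrite (cases _ _ lt_k lt Ea Eb).
- by rewrite (cases _ _ lt_k (idx_lt_idx1 a) Ea Eb).
- by rewrite (cases _ _ lt_k (idx_lt_idx2 a) Ea Eb).
- by move: lt_k; rewrite Ea Eb /=; have := ltn_ord b; lia.
- by move: lt_k; rewrite Ea Eb ltnn.
- by rewrite (cases _ _ lt_k (lt_idx12 n) Ea Eb).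
- by move: lt_k; rewrite Ea Eb /=; have := ltn_ord b; lia.
- by move: lt_k; rewrite Ea Eb /=; lia.
- by move: lt_k; rewrite Ea Eb ltnn.
Qed.

Lemma coords_cut (R : comNzRingType) Y Z D : @coords n R Y Z D (cut_idx n) = 0.
Proof.
by rewrite /coords fst_pair_idx snd_pair_idx (unsplitK (inr ord0)).
Qed.

End CoordinateValues.

Section Kernels.
Variables (n : nat) (n_gt1 : (1 < n)%N).
Local Notation m := (n + 2)%N.
Local Notation N := #|plucker_index m|.

Definition theta_int (Q : {mpoly int[N]}) : {mpoly int[m + m]} :=
  int_eval (wedge (@gen_u n int) (@gen_v n int)) Q.

Definition to_Zform (C : fieldType) (k : 'I_N) : divisor_ring C n :=
  Delta C (fst_idx k) (snd_idx k).

Section Divisor.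
Variables (C : fieldType) (char0 : forall i, i.+1%:R != 0 :> C).

Lemma to_Zform_eval Q : int_eval (to_Zform C) Q = to_divisor C n (map_mpoly intr Q).
Proof.
pose f : {rmorphism {mpoly int[N]} -> divisor_ring C n} := to_divisor C n \o map_mpoly intr.
apply: (@int_rmorph_ext _ _ (mmap intr (to_Zform C)) f) => k.
transitivity (int_eval (to_Zform C) 'X_k); first by [].
rewrite int_evalX; transitivity (to_divisor C n (map_mpoly intr 'X_k)); last by [].
by rewrite map_mpolyX to_divisorX.
Qed.

Lemma theta_int_map Q : map_mpoly intr (theta_int Q)
  = mmap (@mpolyC (m + m) C) (wedge (@gen_u n C) (@gen_v n C)) (map_mpoly intr Q).
Proof.
pose g : {rmorphism {mpoly C[N]} -> {mpoly C[m + m]}} :=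
  mmap (@mpolyC (m + m) C) (wedge (@gen_u n C) (@gen_v n C)).
pose f : {rmorphism {mpoly int[N]} -> {mpoly C[m + m]}} := g \o map_mpoly intr.
rewrite /theta_int rmorph_int_eval.
apply: (@int_rmorph_ext _ _ (mmap intr _) f) => k.
set h := (X in mmap _ X); transitivity (int_eval h 'X_k); first by [].
rewrite int_evalX; transitivity (g (map_mpoly intr 'X_k)); last by [].
rewrite map_mpolyX /g /= mmapX mmap1U /h /= /wedge rmorphB !rmorphM /=.
have Eu i : map_mpoly intr (@gen_u n int i) = @gen_u n C i.
  by rewrite /gen_u; case: ifP; rewrite ?map_mpolyX ?rmorph0.
have Ev i : map_mpoly intr (@gen_v n int i) = @gen_v n C i by rewrite /gen_v map_mpolyX.
by rewrite !Eu !Ev.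
Qed.

(** The integers embed in C, so a relation with integer coefficients between
    the Pluecker coordinates can be tested over C at the generic point. *)
Lemma to_Zform_kernel Q : int_eval (to_Zform C) Q = 0 <-> theta_int Q = 0.
Proof.
rewrite to_Zform_eval; split=> [/(theta_eq0_of_divisor char0)|th0].
  rewrite -theta_int_map => th0; apply/mpolyP => e; rewrite mcoeff0.
  apply: (intr_eq0_char0 char0); have := congr1 (mcoeff e) th0.
  by rewrite mcoeff0 mcoeff_map_mpoly.
by apply: divisor_eq0_of_theta => //; rewrite -theta_int_map th0 rmorph0.
Qed.

End Divisor.

Section FrameKernel.
Variables (F : fieldType) (Y Z : 'I_n -> F) (D : 'I_n -> 'I_n -> F).
Hypothesis frm : frame Y Z D.
Hypothesis indep : forall H, rim_eval Y (rim n_gt1 Y Z D) H = 0 -> H = 0.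

Lemma frame_Y_neq0 a : Y a != 0.
Proof.
apply/eqP => Ya0; have /eqP : 'X_a = 0 :> rim_poly n.
  by apply: indep; rewrite rim_eval_var.
by rewrite -msupp_eq0 msuppX.
Qed.

(** The generic point is a frame over an integral domain, so independence carries
    relations from F to it; and F receives a specialization of the generic point by
    which the given frame is realized. *)
Lemma frame_kernel Q : int_eval (coords Y Z D) Q = 0 <-> theta_int Q = 0.
Proof.
have gu1 : @gen_u n int (idx1 n) = 0 by rewrite /gen_u /= ltnNge leq_addr.
have gu2 : @gen_u n int (idx2 n) = 0 by rewrite /gen_u /= ltnNge leq_addr.
split=> [al0|th0].
  rewrite /theta_int -(int_eval_eq Q (coords_wedge _ gu1 gu2)).
  apply: (rim_independent_kernel frm (wedge_frame _ _) indep _ al0).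
  apply/lregP/prodf_neq0 => a _; rewrite /wedge_Y mulf_neq0 //.
    by rewrite /gen_u /= (ltn_ord a) -msupp_eq0 msuppX.
  by rewrite -msupp_eq0 msuppX.
have [u [v [u1 u2 uvE]]] := frame_realized n_gt1 frm frame_Y_neq0.
pose pt (i : 'I_(m + m)) : F := match split i with inl a => u a | inr b => v b end.
rewrite (int_eval_eq Q uvE).
transitivity (mmap intr pt (theta_int Q)); last by rewrite th0 mmap0.
rewrite /theta_int rmorph_int_eval; apply: int_eval_eq => k /=.
rewrite (rmorph_wedge (mmap intr pt)) /wedge /=.
have evu i : mmap intr pt (@gen_u n int i) = u i.
  rewrite /gen_u; case: ifP => [_|/negbT].
    by rewrite mmapX mmap1U /pt (unsplitK (inl i)).
  rewrite -leqNgt mmap0 => le_ni; have lt_i := ltn_ord i.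
  have [E|E] : (i = n :> nat) \/ (i = n + 1 :> nat)%N by lia.
    by rewrite (_ : i = idx1 n) ?u1 //; apply: val_inj; rewrite /= E addn0.
  by rewrite (_ : i = idx2 n) ?u2 //; apply: val_inj.
have evv i : mmap intr pt (@gen_v n int i) = v i.
  by rewrite /gen_v mmapX mmap1U /pt (unsplitK (inr i)).
by rewrite !evu !evv.
Qed.

End FrameKernel.

End Kernels.

(** * Relations between the cluster variables *)

Lemma frame_of_exchanges n (R : comNzRingType) (Y Z : 'I_n -> R)
    (D X : 'I_n -> 'I_n -> R) :
    (forall a b : 'I_n, (a < b)%N -> Y a * Z b = D a b + X a b) ->
    (forall a b : 'I_n, (a < b)%N -> Y b * Z a = D a b + X a b) ->
    (forall a b c : 'I_n, (a < b)%N -> (b < c)%N ->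
       Y a * X b c = D a b * Y c + X a c * Y b) ->
  frame Y Z D.
Proof.
move=> relYZ relZY relX.
have prop a b : Y a * Z b = Y b * Z a.
  case: (ltngtP a b) => [lt_ab|lt_ba|/val_inj -> //].
    by rewrite relYZ // relZY.
  by rewrite relZY // relYZ.
split=> // a b c lt_ab lt_bc; have lt_ac := ltn_trans lt_ab lt_bc.
have XE (i j : 'I_n) : (i < j)%N -> X i j = Y i * Z j - D i j.
  by move=> lt_ij; rewrite relYZ // addrC addKr.
have := relX a b c lt_ab lt_bc; rewrite !XE // => rel.
transitivity (Y a * (Y b * Z c) - Y a * (Y b * Z c - D b c) + Y c * D a b).
  by ring.
by rewrite rel; ring.
Qed.

Section SpecialAlgebra.
Variables (n : nat) (n_ge3 : (3 <= n)%N) (F : fieldType) (p : side_orbit n -> F).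
Variables (amb : ambient n p) (s0 : seed n p) (x : label n -> F).
Hypothesis special : special_D x s0.
Local Notation V := (vertex n).
Local Notation vx i := (@lshift n n i : V).
Local Notation vb i := (@rshift n n i : V).
Local Notation orbit := (@Defs.orbit n).
Local Notation elt := (symbol_elt p x).

Lemma elt_label (s : symbol n) (ls : is_label s) : elt s = x (Sub s ls).
Proof.
by rewrite /symbol_elt insubN ?(label_not_side n_ge3) //= /symbol_var insubT.
Qed.

Lemma elt_side (a b : V) (ab : is_side_orbit (orbit a b)) :
  elt (plain a b) = p (Sub (orbit a b) ab).
Proof. by rewrite /symbol_elt /= insubT. Qed.

Lemma elt_coef (s : symbol n) : elt s = trop_val p (side_coef s) * symbol_var x s.
Proof.
rewrite /symbol_elt /side_coef; case: insubP => [O sO _|not_side] /=.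
  rewrite trop_val_gen /symbol_var insubN ?mulr1 //.
  by apply: contraL sO; exact: label_not_side.
by rewrite trop_val0 mul1r.
Qed.

Lemma mon_elt (M : seq (symbol n)) :
  trop_val p (mon_coef M) * mon_var x M = \prod_(s <- M) elt s.
Proof.
rewrite (trop_val_sum amb) -big_split; apply: eq_bigr => s _.
by rewrite elt_coef.
Qed.

(** Labels are disjoint from sides, so in each monomial every factor contributes
    either a generator of the coefficient group or a cluster variable, but not
    both; the two terms of the exchange relation become products of elements. *)
Lemma exchange_relation z z' M N : special_exchange z z' M N ->
    is_label z -> is_label z' ->
  elt z * elt z' = \prod_(s <- M) elt s + \prod_(s <- N) elt s.
Proof.
move=> ex lz lz'; have [k [s [t [_ mu [vars mons]]]]] := special_exchange_all special ex.
have E (u : symbol n) (lu : is_label u) : elt u = symbol_var x u.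
  by rewrite elt_label /symbol_var insubT.
rewrite (E _ lz) (E _ lz').
transitivity (\prod_(y <- [:: symbol_var x z; symbol_var x z']) y).
  by rewrite !big_cons big_nil mulr1.
rewrite -(perm_big _ vars) !big_cons big_nil /= mulr1 (mut_exchange mu) -!mon_elt.
transitivity (\sum_(cm <- [:: (mon_coef M, mon_var x M); (mon_coef N, mon_var x N)])
    trop_val p cm.1 * cm.2); last by rewrite !big_cons big_nil addr0.
by rewrite -(perm_big _ mons) !big_cons big_nil /= addr0.
Qed.

Definition diam_var (a : 'I_n) : F := elt (plain (vx a) (vb a)).
Definition tilde_var (a : 'I_n) : F := elt (tilde (vx a)).
Definition chord_var (a b : 'I_n) : F := elt (plain (vx a) (vx b)).
Definition cross_var (a b : 'I_n) : F := elt (plain (vx a) (vb b)).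

Lemma is_label_diameter (a : 'I_n) : is_label (plain (vx a) (vb a)).
Proof. by rewrite -antipode_vx is_label_plain ?diagonal_diameter. Qed.

Lemma plain_bar (i j : 'I_n) : plain (vb i) (vx j) = plain (vx i) (vb j).
Proof. by rewrite -antipode_vx -[vx j]antipode_vb plain_antipode. Qed.

Lemma prod_elt2 (s t : symbol n) : \prod_(u <- [:: s; t]) elt u = elt s * elt t.
Proof. by rewrite big_cons big_seq1. Qed.

Lemma diam_tilde_lt (a b : 'I_n) : (a < b)%N ->
  diam_var a * tilde_var b = chord_var a b + cross_var a b.
Proof.
move=> lt_ab; have := exchange_relation (special_exchange3 (ccw_vx2 n_ge3 lt_ab)).
rewrite !antipode_vx !big_seq1; apply; last exact: is_label_tilde.
exact: is_label_diameter.
Qed.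

(** The same exchange relation, for b and the antipode of a. *)
Lemma diam_tilde_gt (a b : 'I_n) : (a < b)%N ->
  diam_var b * tilde_var a = chord_var a b + cross_var a b.
Proof.
move=> lt_ab; have := exchange_relation (special_exchange3 (ccw_vx2' n_ge3 lt_ab)).
rewrite !antipode_vx antipode_vb !big_seq1.
rewrite -[tilde (vb a)]tilde_antipode antipode_vb.
rewrite [plain (vx b) (vx a)]plainC [plain (vx b) (vb a)]plainC plain_bar.
rewrite [_ + elt (plain (vx a) (vx b))]addrC; apply; last exact: is_label_tilde.
exact: is_label_diameter.
Qed.

Lemma diam_cross (a b c : 'I_n) : (a < b)%N -> (b < c)%N ->
  diam_var a * cross_var b c = chord_var a b * diam_var c + cross_var a c * diam_var b.
Proof.
move=> lt_ab lt_bc.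
have := exchange_relation (special_exchange4 (ccw_vx3 n_ge3 lt_ab lt_bc)).
rewrite !antipode_vx !prod_elt2; apply; first exact: is_label_diameter.
exact/is_label_plain/(diagonal_vx_vb n_ge3 lt_ab).
Qed.

Lemma special_frame : frame diam_var tilde_var chord_var.
Proof. exact: frame_of_exchanges diam_tilde_lt diam_tilde_gt diam_cross. Qed.

Lemma cross_varE (a b : 'I_n) : (a < b)%N ->
  cross_var a b = diam_var a * tilde_var b - chord_var a b.
Proof. by move=> /diam_tilde_lt ->; rewrite [X in _ = X]addrC addKr. Qed.

End SpecialAlgebra.

(** * Independence and generation in the special cluster algebra *)

Section RimSides.
Variables (n : nat) (n_ge3 : (3 <= n)%N).
Local Notation V := (vertex n).
Local Notation vx i := (@lshift n n i : V).
Local Notation vb i := (@rshift n n i : V).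
Local Notation orbit := (@Defs.orbit n).

Fact next_vertex_subproof (a : 'I_n) : (a.+1 < n + n)%N.
Proof. by have := ltn_ord a; lia. Qed.

Definition next_vertex (a : 'I_n) : V := Ordinal (next_vertex_subproof a).

Lemma next_vertex_side (a : 'I_n) : is_side_orbit (orbit (vx a) (next_vertex a)).
Proof.
rewrite is_side_orbitE // /side !ccw_distE //=.
by do !case: ifP; lia.
Qed.

Definition rim_side (a : 'I_n) : side_orbit n :=
  Sub (orbit (vx a) (next_vertex a)) (next_vertex_side a).

Lemma rim_side_inj : injective rim_side.
Proof.
move=> a b /(congr1 val) /= /orbit_inj E; apply: val_inj => /=.
have lta := ltn_ord a; have ltb := ltn_ord b.
by case: E => [] [/(congr1 val) E1 /(congr1 val) E2]; move: E1 E2;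
  rewrite /= ?antipode_val /=; do ?case: ifP; lia.
Qed.

End RimSides.

Section SpecialCluster.
Variables (n : nat) (n_ge3 : (3 <= n)%N) (F : fieldType) (p : side_orbit n -> F).
Variables (amb : ambient n p) (s0 : seed n p) (x : label n -> F).
Hypothesis special : special_D x s0.
Local Notation V := (vertex n).
Local Notation vx i := (@lshift n n i : V).
Local Notation vb i := (@rshift n n i : V).
Local Notation orbit := (@Defs.orbit n).
Local Notation elt := (symbol_elt p x).
Let n_gt1 : (1 < n)%N := ltnW n_ge3.
Local Notation Y := (diam_var p x).
Local Notation Z := (tilde_var p x).
Local Notation D := (chord_var p x).

(** For a < n this is the side from a to a + 1; the last rim element is
    the variable of the chord from 1 to the antipode of n, and this chord is a side. *)
Lemma rim_special a : rim n_gt1 Y Z D a = p (rim_side n_ge3 a).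
Proof.
rewrite /rim; have side_a := next_vertex_side n_ge3 a.
have -> : p (rim_side n_ge3 a) = elt (plain (vx a) (next_vertex n_ge3 a)).
  by rewrite (elt_side _ _ side_a); congr (p _); apply: val_inj.
case: insubP => [b _ Eb|ge_n].
  by rewrite /chord_var; congr (elt (plain _ _)); apply: val_inj.
rewrite -(cross_varE n_ge3 amb special (first_lt_last n_gt1)) /cross_var.
have a_last : a = last_idx n_gt1.
  by apply: val_inj; move: ge_n (ltn_ord a) => /=; lia.
have -> : next_vertex n_ge3 a = vb (first_idx n_gt1).
  by apply: val_inj; move: ge_n (ltn_ord a) => /=; lia.
by rewrite a_last [plain (vx (last_idx _)) _]plainC plain_bar.
Qed.

Lemma coef_eval (q : {mpoly int[n]}) :
  mmap intr (p \o rim_side n_ge3) q = 0 -> q = 0.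
Proof.
pose e a := enum_rank (rim_side n_ge3 a) => q0.
have int0 i : i.+1%:R != 0 :> int by rewrite pnatr_eq0.
apply: (rename_eq0 int0 (e := e)); first by move=> a b /enum_rank_inj/rim_side_inj.
apply: (proj1 amb); rewrite meval_map_mpoly rename_map_eval -[RHS]q0.
apply: (@int_rmorph_ext _ _ (mmap intr _) (mmap intr _)) => k.
by rewrite /= !mmapX !mmap1U /= /e enum_rankK.
Qed.

Lemma coef_eval_over (q : {mpoly int[n]}) :
  mmap intr (p \o rim_side n_ge3) q \in subfield_pred (fun y => exists j, y = p j).
Proof.
rewrite /mmap; apply: rpred_sum => e _; apply: rpredM; first exact: rpred_int.
by apply: rpred_prod => i _; apply/rpredX/asboolP/in_subfield_gen; eexists.
Qed.

(** The diameters of the first colour are a maximal set of non-crossing orbits; the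
    injection w matches the order in which the seed lists its variables. *)
Lemma diam_cluster : exists s (w : 'I_n -> 'I_n),
  injective w /\ forall a, Y a = cvar (s : seed n p) (w a).
Proof.
have [s _ sP] := (special_clusters special _).1 (plain_diameters_maximal n_ge3).
have in_s a : exists i, x (plain_diameter n_ge3 a) = cvar s i.
  by apply/sP/imset_f.
exists s, (fun a => sval (cid (in_s a))).
have YE a : Y a = cvar s (sval (cid (in_s a))).
  rewrite -(svalP (cid (in_s a))) /diam_var.
  rewrite (elt_label n_ge3 _ _ (is_label_diameter n_ge3 a)); congr x.
  by apply: val_inj; rewrite val_plain_diameter.
split=> // a b eq_ab.
have := svalP (cid (in_s a)); rewrite /= [sval (cid (in_s a))]eq_ab.
rewrite -(svalP (cid (in_s b))) => /(special_label_inj special).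
exact: plain_diameter_inj.
Qed.

(** Evaluating the inner polynomials gives a polynomial over the coefficient field
    that vanishes at the variables of a cluster, so each inner polynomial vanishes
    at the generators of the coefficient group. *)
Lemma rim_special_independent H : rim_eval Y (rim n_gt1 Y Z D) H = 0 -> H = 0.
Proof.
have [s [w [w_inj YE]]] := diam_cluster; have [indep _] := seed_basis s.
have char0 := ambient_char0 amb => H0.
pose f : {rmorphism {mpoly int[n]} -> F} := mmap intr (p \o rim_side n_ge3).
pose Q := map_mpoly f H.
have Q0 : Q = 0.
  apply: (rename_eq0 char0 w_inj); apply: indep.
    apply/(mpolyOver_subfieldP (fun y => exists j, y = p j)).
    apply: rename_over; apply/mpolyOverP => d; rewrite mcoeff_map_mpoly.
    exact: coef_eval_over.
  rewrite /meval rename_map_eval -[RHS]H0.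
  transitivity (mmap f (cvar s \o w) H); first exact: meval_map_mpoly.
  rewrite /rim_eval /mmap; apply: eq_bigr => d _; congr (_ * _).
    apply: (@int_rmorph_ext _ _ f (mmap intr _)) => k.
    by rewrite /= !mmapX !mmap1U rim_special.
  by apply: mmap1_eq => a; rewrite YE.
apply/mpolyP => d; rewrite mcoeff0; apply: coef_eval.
by rewrite -[mmap _ _ _]/(f _) -mcoeff_map_mpoly -/Q Q0 mcoeff0.
Qed.

Local Notation gens := (cluster_generator s0).
Local Notation h := (coords Y Z D).

Definition covered (y : F) : Prop := exists Q, y = int_eval h Q.

Lemma covered_sub y z : covered y -> covered z -> covered (y - z).
Proof. by move=> [P ->] [Q ->]; exists (P - Q); rewrite /int_eval mmapB. Qed.

Lemma covered_mul y z : covered y -> covered z -> covered (y * z).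
Proof. by move=> [P ->] [Q ->]; exists (P * Q); rewrite /int_eval rmorphM. Qed.

Lemma covered1 : covered 1.
Proof. by exists 1; rewrite /int_eval rmorph1. Qed.

Lemma covered_Y a : covered (Y a).
Proof. by exists 'X_(pair_idx (idx_lt_idx1 a)); rewrite int_evalX coords_Y. Qed.

Lemma covered_Z a : covered (Z a).
Proof. by exists 'X_(pair_idx (idx_lt_idx2 a)); rewrite int_evalX coords_Z. Qed.

Lemma covered_D (a b : 'I_n) : (a < b)%N -> covered (D a b).
Proof.
move=> lt; have lt' : (idx a < idx b)%N by [].
by exists 'X_(pair_idx lt'); rewrite int_evalX coords_D.
Qed.

Lemma covered_plain (a b : V) : a != b -> covered (elt (plain a b)).
Proof.
case/plain_cases=> [[i ->]|[i [j [lt ->]]]|[i [j [lt ->]]]].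
- exact: covered_Y.
- exact: covered_D.
rewrite -[elt _]/(cross_var p x i j) (cross_varE n_ge3 amb special lt).
by apply: covered_sub; [apply: covered_mul (covered_Y _) (covered_Z _)|apply: covered_D].
Qed.

Lemma covered_label l : covered (x l).
Proof.
have -> : x l = elt (val l).
  by rewrite (elt_label n_ge3 _ _ (valP l)); congr x; exact: val_inj.
case/orP: (valP l) => [/existsP[a /existsP[b /andP[/andP[ne _] /eqP ->]]]|/existsP[a /eqP ->]].
  exact: covered_plain.
by have [i ->] := tilde_cases a; exact: covered_Z.
Qed.

Lemma covered_p j : covered (p j).
Proof.
case: j => O sO; case/existsP: (sO) => a /existsP[b /andP[sd /eqP OE]].
move: sO; rewrite OE => sO; rewrite -[p _]/(p (Sub (orbit a b) sO)) -(elt_side p x).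
apply: covered_plain; apply: contraTneq sd => ->.
by rewrite /side ccw_distE // leqnn subnn.
Qed.

Lemma covered_mon_coef (M : seq (symbol n)) : covered (trop_val p (mon_coef M)).
Proof.
rewrite (trop_val_sum amb); elim: M => [|s M IHM].
  by rewrite big_nil; exact: covered1.
rewrite big_cons; apply: covered_mul IHM; rewrite /side_coef.
case: insubP => [O _ _|_] /=; last by rewrite trop_val0; exact: covered1.
by rewrite trop_val_gen; exact: covered_p.
Qed.

(** The coefficients of a seed in direction k occur in the exchange relation of
    the mutation in that direction, whose coefficients are products of generators
    attached to sides. *)
Lemma covered_coef s k : mutation_equivalent s0 s ->
  covered (trop_val p (pplus s k)) /\ covered (trop_val p (pminus s k)).
Proof.
move=> eq_s; have sk := type_D_skew (special_type special) eq_s.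
have [t mu] := mutation_exists amb k sk.
have [z [z' [M [N [_ [_ mons]]]]]] := special_exchange_only special eq_s mu.
have cov c : c \in [:: (pplus s k, mon_plus s k); (pminus s k, mon_minus s k)] ->
    covered (trop_val p c.1).
  by rewrite (perm_mem mons) !inE => /orP[] /eqP -> /=; exact: covered_mon_coef.
split; first exact: (cov (pplus s k, mon_plus s k) (mem_head _ _)).
by apply: (cov (pminus s k, mon_minus s k)); rewrite !inE eqxx orbT.
Qed.

Lemma covered_gens y : gens y -> covered y.
Proof.
case=> s [i [eq_s [->|->|->]]].
- have [l ->] := (special_variables special (cvar s i)).2 (ex_intro _ s (ex_intro _ i (conj eq_s erefl))).
  exact: covered_label.
- by case: (covered_coef i eq_s).
by case: (covered_coef i eq_s).
Qed.

Lemma label_generated l : x l \in subring_pred gens.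
Proof.
have [s [i [eq_s xE]]] := (special_variables special (x l)).1 (ex_intro _ l erefl).
by apply/asboolP/in_subring_gen; exists s, i; split=> //; constructor.
Qed.

(** A diagonal is a cluster variable.  For a side from a to b = a + 1, the generator
    of this side is the coefficient of the first term in the exchange relation for
    the two diameters at a and b. *)
Lemma chord_generated (a b : 'I_n) : (a < b)%N -> D a b \in subring_pred gens.
Proof.
move=> lt; rewrite /chord_var; have [sd|nsd] := boolP (side (vx a) (vx b)); last first.
  have lab : is_label (plain (vx a) (vx b)).
    apply: is_label_plain; rewrite /diagonal nsd andbT -val_eqE /=.
    by rewrite neq_ltn lt.
  by rewrite (elt_label n_ge3 _ _ lab); exact: label_generated.
have so : is_side_orbit (orbit (vx a) (vx b)) by rewrite is_side_orbitE.
rewrite (elt_side _ _ so).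
have [k [s [t [eq_s mu [_ mons]]]]] :=
  special_exchange_all special (special_exchange3 (ccw_vx2 n_ge3 lt)).
have coefE : mon_coef [:: plain (vx a) (vx b)] = trop_gen (Sub (orbit (vx a) (vx b)) so).
  by rewrite /mon_coef big_seq1 /side_coef /= insubT.
have : (trop_gen (Sub (orbit (vx a) (vx b)) so), mon_var x [:: plain (vx a) (vx b)])
    \in [:: (pplus s k, mon_plus s k); (pminus s k, mon_minus s k)].
  by rewrite (perm_mem mons) -coefE mem_head.
rewrite !inE => /orP[] /eqP[E _]; apply/asboolP/in_subring_gen; exists s, k; split=> //.
  by rewrite -(trop_val_gen p) E; constructor.
by rewrite -(trop_val_gen p) E; constructor.
Qed.

Lemma coords_generated k : h k \in subring_pred gens.
Proof.
elim/coords_ind: k => [a b lt|a|a|].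
- by rewrite coords_D; exact: chord_generated.
- rewrite coords_Y /diam_var (elt_label n_ge3 _ _ (is_label_diameter n_ge3 a)).
  exact: label_generated.
- rewrite coords_Z /tilde_var (elt_label n_ge3 _ _ (is_label_tilde _)).
  exact: label_generated.
by rewrite coords_cut rpred0.
Qed.

Lemma special_cover y : in_subring gens y <-> exists Q, y = int_eval h Q.
Proof.
split=> [|[Q ->]].
  elim=> {y} [y /covered_gens //||y z _ cy _ cz|y z _ cy _ cz].
  - exact: covered1.
  - exact: covered_sub.
  exact: covered_mul.
apply/asboolP; rewrite -[asbool _]/(_ \in subring_pred gens) /int_eval /mmap.
apply: rpred_sum => e _; apply: rpredM; first exact: rpred_int.
by apply: rpred_prod => k _; apply/rpredX/coords_generated.
Qed.

End SpecialCluster.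

(** * The isomorphism *)

Lemma to_Zform_cover (C : fieldType) n (y : divisor_ring C n) :
  in_subring (fun y => exists i j : 'I_(n + 2), (i < j)%N /\ y = Delta C i j) y <->
  exists Q, y = int_eval (to_Zform C) Q.
Proof.
set T := (fun y => _); split=> [|[Q ->]].
  elim=> {y} [y [i [j [lt ->]]]||y z _ [P ->] _ [Q ->]|y z _ [P ->] _ [Q ->]].
  - exists 'X_(pair_idx lt); rewrite int_evalX /to_Zform.
    by rewrite fst_pair_idx snd_pair_idx.
  - by exists 1; rewrite /int_eval rmorph1.
  - by exists (P - Q); rewrite /int_eval rmorphB.
  by exists (P * Q); rewrite /int_eval rmorphM.
apply/asboolP; rewrite -[asbool _]/(_ \in subring_pred T) /int_eval /mmap.
apply: rpred_sum => e _; apply: rpredM; first exact: rpred_int.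
apply: rpred_prod => k _; apply/rpredX/asboolP/in_subring_gen.
by exists (fst_idx k), (snd_idx k); split; first exact: fst_lt_snd.
Qed.

Lemma extends_on_coords (C : fieldType) n (F : fieldType) (p : side_orbit n -> F)
    (s0 : seed n p) (x : label n -> F)
    (psi : {rmorphism cluster_algebra s0 -> divisor_Zform C n}) :
  extends_correspondence x psi -> forall k, k != cut_idx n ->
  sends psi (coords (diam_var p x) (tilde_var p x) (chord_var p x) k) (to_Zform C k).
Proof.
case=> sendY sendZ sendD _; apply: coords_ind => [a b lt|a|a|].
- by rewrite coords_D /to_Zform fst_pair_idx snd_pair_idx => _; exact: sendD.
- by rewrite coords_Y /to_Zform fst_pair_idx snd_pair_idx => _; exact: sendY.
- by rewrite coords_Z /to_Zform fst_pair_idx snd_pair_idx => _; exact: sendZ.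
by rewrite eqxx.
Qed.

Theorem proposition12p16 (R : realType) (n : nat) (n_ge3 : (3 <= n)%N)
    (F : fieldType) (p : side_orbit n -> F) (F_ambient : ambient n p)
    (s0 : seed n p) (x : label n -> F) (s0_special : special_D x s0) :
  exists phi : {rmorphism cluster_algebra s0 -> divisor_Zform R[i] n},
    [/\ bijective phi, extends_correspondence x phi
      & forall psi : {rmorphism cluster_algebra s0 -> divisor_Zform R[i] n},
          bijective psi -> extends_correspondence x psi -> psi =1 phi].
Proof.
pose h := coords (diam_var p x) (tilde_var p x) (chord_var p x).
pose alpha : {rmorphism {mpoly int[#|plucker_index (n + 2)|]} -> F} := mmap intr h.
pose beta : {rmorphism {mpoly int[#|plucker_index (n + 2)|]} -> divisor_ring R[i] n} :=
  mmap intr (to_Zform R[i]).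
have char0 i : i.+1%:R != 0 :> R[i] by rewrite pnatr_eq0.
have same_kernel q : alpha q = 0 <-> beta q = 0.
  apply: iff_trans (iff_sym (to_Zform_kernel char0 q)).
  apply: (frame_kernel (n_gt1 := ltnW n_ge3)
    (special_frame n_ge3 F_ambient s0_special)) => H.
  exact: (rim_special_independent F_ambient s0_special).
have coverA : forall y, in_subring (cluster_generator s0) y <-> exists q, y = alpha q :=
  special_cover n_ge3 F_ambient s0_special.
have coverB := @to_Zform_cover R[i] n.
have [phi [phi_bij phiE]] := cover_isomorphism coverA coverB same_kernel.
(* The X_ij already determine the images of all labels, as the chord from a to the
   antipode of b is a polynomial in them. *)
have phi_sends q : sends phi (alpha q) (beta q).
  by exists (corestrict coverA q); [|apply: phiE].
have alphaX k : alpha 'X_k = h k by exact: int_evalX.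
have betaX k : beta 'X_k = to_Zform R[i] k by exact: int_evalX.
have phi_ext : extends_correspondence x phi.
  split=> [a|a|a b lt|a b lt].
  - have := phi_sends 'X_(pair_idx (idx_lt_idx1 a)).
    by rewrite alphaX betaX /h coords_Y /to_Zform fst_pair_idx snd_pair_idx.
  - have := phi_sends 'X_(pair_idx (idx_lt_idx2 a)).
    by rewrite alphaX betaX /h coords_Z /to_Zform fst_pair_idx snd_pair_idx.
  - have lt' : (idx a < idx b)%N by [].
    have := phi_sends 'X_(pair_idx lt').
    by rewrite alphaX betaX /h coords_D /to_Zform fst_pair_idx snd_pair_idx.
  have lt' : (idx a < idx b)%N by [].
  have := phi_sends ('X_(pair_idx (idx_lt_idx1 a)) * 'X_(pair_idx (idx_lt_idx2 b))
    - 'X_(pair_idx lt')).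
  rewrite !rmorphB !rmorphM !alphaX !betaX /h coords_D coords_Y coords_Z.
  rewrite /to_Zform !fst_pair_idx !snd_pair_idx.
  by rewrite -(cross_varE n_ge3 F_ambient s0_special lt).
exists phi; split=> // psi _ psi_ext u; have [q ->] := corestrict_surj coverA u.
pose lift : {rmorphism {mpoly int[#|plucker_index (n + 2)|]} -> cluster_algebra s0} :=
  corestrict coverA.
apply: (@int_rmorph_ext _ _ (psi \o lift) (phi \o lift)) => k.
transitivity (psi (lift 'X_k)); first by [].
transitivity (phi (lift 'X_k)); last by [].
have [k_cut|k_cut] := eqVneq k (cut_idx n).
  have -> : lift 'X_k = 0.
    by apply: val_inj; rewrite /= [LHS]alphaX /h k_cut coords_cut.
  by rewrite !rmorph0.
have [v vE psiv] := extends_on_coords psi_ext k_cut.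
have [w wE phiw] := extends_on_coords phi_ext k_cut.
have lift_eq (y : cluster_algebra s0) : subring_val y = h k -> lift 'X_k = y.
  by move=> yE; apply: val_inj; rewrite /= [LHS]alphaX -yE.
apply: val_inj; rewrite {1}(lift_eq v vE) (lift_eq w wE).
exact: (etrans psiv (esym phiw)).
Qed.
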